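(* There exists a universal constant $L>0$ such that the following holds. Let $d\ge1$, $\sigma>0$, $\rho>d+1$, and let $(X,Y)$ be an $\mathbb R^d\times\mathbb R^d$-valued martingale pair (i.e. $\mathbb E[Y|X]=X$) with $\mathbb E[|(X,Y)|_2^{2p}]<\infty$ for some $p>d+1$; let $q$ be the conjugate exponent of $p$, $p^{-1}+q^{-1}=1$. Let $\mathbb P_n$ be the empirical measure of $n$ i.i.d. copies of $(X,Y)$ and let the smoothing variable $\xi$ have density $f_{\xi,\rho,\sigma}(x)=\sigma^{-d}C_\rho(|x|_2/\sigma+1)^{-\rho}$, where $C_\rho^{-1}=\int_{\mathbb R^d}(|x|_2+1)^{-\rho}\,dx$. Then $$\begin{aligned}\mathbb E\big[\mathrm{MPD}^{*\xi}(\mathbb P_n,1)\big]\le{}& L n^{-1/2}\sum_{j=1}^d\|X^j-Y^j\|_{2p}\,C_\rho\Bigg[d^{3/2}\rho\left(\mathbb E[|X|_2^{2p}]^{1/(2q)}2^{p-1}\frac{\sigma^{-p}}{p-1-d}+2^{\rho+1}\frac{\sigma^{-1}}{\rho+1-d}\right)\\&+d\left(\mathbb E[|X|_2^{2p}]^{1/(2q)}2^{p-1}\frac{\sigma^{-(p-1)}}{p-1-d}+2^{\rho}\frac{1}{\rho-d}\right)+\big(\sqrt d\,\rho\,\sigma^{-(d+1)}+\sigma^{-d}\big)(\sigma^d+1)\Bigg].\end{aligned}$$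
   Context: $|\cdot|_2$ is the Euclidean norm, $X^j,Y^j$ are the $j$-th coordinates of $X,Y$, and $\|Z\|_{p}=\mathbb E[|Z|^{p}]^{1/p}$. $\mathbb P_n=\frac1n\sum_{i=1}^n\delta_{(X_i,Y_i)}$. For probability measures $\mathbb P,\mathbb Q$ on $\mathbb R^d\times\mathbb R^d$, a probability measure $\pi$ on $(\mathbb R^d)^4$, with $(X,Y,X',Y')\sim\pi$, is a bi-causal coupling of $\mathbb P$ and $\mathbb Q$ if $(X,Y)\sim\mathbb P$, $(X',Y')\sim\mathbb Q$, $\mathrm{Law}(Y|X,X')=\mathrm{Law}(Y|X)$ and $\mathrm{Law}(Y'|X,X')=\mathrm{Law}(Y'|X')$. $\mathcal{AW}_1(\mathbb P,\mathbb Q)=\inf_\pi\mathbb E[|Y-Y'|_2+|X-X'|_2]$ over bi-causal couplings $\pi$. With $\mathbb P^{*\xi}$ the law of $(X+\xi,Y+\xi)$, where $(X,Y)\sim\mathbb P$ is independent of $\xi$, $$\mathrm{MPD}^{*\xi}(\mathbb P,1)=\inf\{\mathcal{AW}_1(\mathbb P^{*\xi},\mathbb Q):\ \mathbb E[Y'|X']=X'\text{ for }(X',Y')\sim\mathbb Q\}.$$ *)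

(* Defs.v *)
From HB Require Import structures.
From mathcomp Require Import all_boot all_order all_algebra.
From mathcomp Require Import all_classical all_reals all_analysis measurable_realfun.
Set Implicit Arguments.
Unset Strict Implicit.
Unset Printing Implicit Defensive.
Import Order.TTheory GRing.Theory Num.Theory.
Import numFieldNormedType.Exports.
Local Open Scope classical_set_scope.
Local Open Scope ring_scope.

Lemma pushforward_semi_sigma_additive d d' (T : measurableType d)
    (T' : measurableType d') (R : realType) (m : {measure set T -> \bar R})
    (f : T -> T') : measurable_fun setT f ->
  semi_sigma_additive (pushforward m f).
Proof.
move=> mf; have mt A : measurable A -> measurable (f @^-1` A).
  by move=> mA; rewrite -[X in measurable X]setTI; exact: mf.
move=> F mF tF mUF; rewrite /pushforward preimage_bigcup.
apply: measure_semi_sigma_additive.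
- by move=> n; exact: mt.
- apply/trivIsetP => /= i j _ _ ij; rewrite -preimage_setI.
  by move/trivIsetP : tF => /(_ _ _ _ _ ij) ->//; rewrite preimage_set0.
- by rewrite -preimage_bigcup; exact: mt.
Qed.

(* R^d is d.-tuple R, whose library sigma-algebra is the product one. *)
Section euclidean_space.
Context {R : realType}.

Definition tadd d (x y : d.-tuple R) : d.-tuple R :=
  [tuple tnth x i + tnth y i | i < d].

Definition tsub d (x y : d.-tuple R) : d.-tuple R :=
  [tuple tnth x i - tnth y i | i < d].

Definition enorm d (x : d.-tuple R) : R :=
  Num.sqrt (\sum_(i < d) tnth x i ^+ 2).

Definition enorm_pair d (z : d.-tuple R * d.-tuple R) : R :=
  Num.sqrt (\sum_(i < d) tnth z.1 i ^+ 2 + \sum_(i < d) tnth z.2 i ^+ 2).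

Definition tcons d (z : d.-tuple R * R) : d.+1.-tuple R :=
  [tuple of z.2 :: z.1].

Lemma measurable_tcons d : measurable_fun [set: d.-tuple R * R] (@tcons d).
Proof. by apply: measurable_cons. Qed.

Lemma measurable_tadd d d' (T : measurableType d') (f g : T -> d.-tuple R) :
  measurable_fun [set: T] f -> measurable_fun [set: T] g ->
  measurable_fun [set: T] (fun x => tadd (f x) (g x)).
Proof.
move=> mf mg; apply/measurable_fun_tnthP => i.
apply: (eq_measurable_fun (fun x => tnth (f x) i + tnth (g x) i)).
  by move=> x _ /=; rewrite tnth_mktuple.
by apply: measurable_funD;
  apply: (measurableT_comp (@measurable_tnth _ _ _ i)).
Qed.

Section lebesgue_tcons.
Variables (d : nat) (mu : {measure set (d.-tuple R) -> \bar R}).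

Definition lebesgue_tcons : set (d.+1.-tuple R) -> \bar R :=
  pushforward (mu \x lebesgue_measure)%E (@tcons d).

Let lebesgue_tcons0 : lebesgue_tcons set0 = 0%E.
Proof. by rewrite /lebesgue_tcons /pushforward preimage_set0 measure0. Qed.

Let lebesgue_tcons_ge0 A : (0 <= lebesgue_tcons A)%E.
Proof. exact: (@measure_ge0 _ _ _ (mu \x lebesgue_measure)%E). Qed.

Let lebesgue_tcons_sigma_additive : semi_sigma_additive lebesgue_tcons.
Proof.
exact: (@pushforward_semi_sigma_additive _ _ _ _ _
  (mu \x lebesgue_measure)%E _ (@measurable_tcons d)).
Qed.

HB.instance Definition _ := isMeasure.Build _ _ _ lebesgue_tcons
  lebesgue_tcons0 lebesgue_tcons_ge0 lebesgue_tcons_sigma_additive.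

End lebesgue_tcons.

(* Lebesgue measure on R^d: the d-fold product of the one-dimensional one,
   carried from R^d * R to R^(d+1) by tcons; on R^0 it is the unit mass. *)
Fixpoint lebesgue_tuple d : {measure set (d.-tuple R) -> \bar R} :=
  match d with
  | 0 => @dirac _ (0.-tuple R) [tuple] R
  | d'.+1 => lebesgue_tcons (lebesgue_tuple d')
  end.

End euclidean_space.

Section conditioning.
Context d (T : measurableType d) (R : realType) (P : probability T R).

(* Z is a version of E[Y | X]. *)
Definition is_cond_exp d1 (U : measurableType d1) (X : T -> U) (Y Z : T -> R) :
    Prop :=
  [/\ P.-integrable setT (EFin \o Y),
      P.-integrable setT (EFin \o Z),
      g_sigma_algebra_preimage Z `<=` g_sigma_algebra_preimage X &
      forall A, g_sigma_algebra_preimage X A ->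
        (\int[P]_(w in A) (Y w)%:E = \int[P]_(w in A) (Z w)%:E)%E].

(* E[Y | X] = X, coordinate by coordinate. *)
Definition martingale_pair k (X Y : T -> k.-tuple R) : Prop :=
  forall j : 'I_k, is_cond_exp X (fun w => tnth (Y w) j) (fun w => tnth (X w) j).

(* k is a regular version of Law(Y | X). *)
Definition is_cond_law d1 d2 (U : measurableType d1) (V : measurableType d2)
    (X : T -> U) (Y : T -> V) (k : R.-pker U ~> V) : Prop :=
  forall A B, measurable A -> measurable B ->
    (P (X @^-1` A `&` Y @^-1` B) = \int[P]_(w in X @^-1` A) k (X w) B)%E.

(* Law(Y | X1) = Law(Y | X2) almost surely; the choice of versions is
   immaterial. *)
Definition same_cond_law d1 d2 d3 (U1 : measurableType d1)
    (U2 : measurableType d2) (V : measurableType d3)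
    (Y : T -> V) (X1 : T -> U1) (X2 : T -> U2) : Prop :=
  exists (k1 : R.-pker U1 ~> V) (k2 : R.-pker U2 ~> V),
    [/\ is_cond_law X1 Y k1, is_cond_law X2 Y k2 &
        {ae P, forall w, forall B, measurable B -> k1 (X1 w) B = k2 (X2 w) B}].

Definition independent_family (I : finType) d1 (U : measurableType d1)
    (S : I -> T -> U) : Prop :=
  forall (J : {set I}) (B : I -> set U), (forall i, measurable (B i)) ->
    (P (\bigcap_(i in [set` J]) (S i @^-1` B i)) =
     \prod_(i in J) P (S i @^-1` B i))%E.

End conditioning.

Section empirical_measure.
Context d (T : measurableType d) (R : realType).
Variables (n : nat) (s : 'I_n -> T).

(* The unused proof of 0 < n is what makes this a probability measure. *)
Definition empirical (_ : (0 < n)%N) : set T -> \bar R :=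
  fun A => ((n%:R^-1)%:E * \sum_(i < n) \d_(s i) A)%E.

Variable n_gt0 : (0 < n)%N.

Let m (k : nat) : {measure set T -> \bar R} :=
  if insub k is Some i then \d_(s i) else mzero.

Let n_inv_ge0 : 0 <= n%:R^-1 :> R.
Proof. by rewrite invr_ge0 ler0n. Qed.

Let empiricalE : empirical n_gt0 = mscale (NngNum n_inv_ge0) (msum m n).
Proof.
apply/funext => A; rewrite /empirical /mscale /msum /=; congr (_ * _)%E.
by apply: eq_bigr => i _; rewrite /m valK.
Qed.

Let empirical0 : empirical n_gt0 set0 = 0%E.
Proof. by rewrite empiricalE measure0. Qed.

Let empirical_ge0 A : (0 <= empirical n_gt0 A)%E.
Proof. by rewrite empiricalE measure_ge0. Qed.

Let empirical_sigma_additive : semi_sigma_additive (empirical n_gt0).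
Proof. rewrite empiricalE; exact: measure_semi_sigma_additive. Qed.

HB.instance Definition _ := isMeasure.Build _ _ _ (empirical n_gt0)
  empirical0 empirical_ge0 empirical_sigma_additive.

Let empirical_setT : empirical n_gt0 setT = 1%E.
Proof.
rewrite /empirical; under eq_bigr do rewrite diracT.
rewrite sumEFin sumr_const card_ord -EFinM mulVf // pnatr_eq0.
by rewrite -lt0n.
Qed.

HB.instance Definition _ := Measure_isProbability.Build _ _ _
  (empirical n_gt0) empirical_setT.

End empirical_measure.
Arguments empirical {d T R n} s n_gt0.

Section smoothing.
Context (R : realType) (d : nat).
Variables (mu : probability (d.-tuple R * d.-tuple R)%type R)
  (nu : probability (d.-tuple R) R).

(* The law of (X + xi, Y + xi) for (X, Y) ~ mu independent of xi ~ nu. *)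
Definition smooth : set (d.-tuple R * d.-tuple R) -> \bar R :=
  pushforward (mu \x nu)%E (fun z => (tadd z.1.1 z.2, tadd z.1.2 z.2)).

Let measurable_shift : measurable_fun setT
  (fun z : (d.-tuple R * d.-tuple R) * d.-tuple R =>
     (tadd z.1.1 z.2, tadd z.1.2 z.2)).
Proof.
apply: measurable_fun_pair; apply: measurable_tadd => //.
  exact: (measurableT_comp measurable_fst measurable_fst).
exact: (measurableT_comp measurable_snd measurable_fst).
Qed.

Let smooth0 : smooth set0 = 0%E.
Proof. by rewrite /smooth /pushforward preimage_set0 measure0. Qed.

Let smooth_ge0 A : (0 <= smooth A)%E.
Proof. exact: (@measure_ge0 _ _ _ (mu \x nu)%E). Qed.

Let smooth_sigma_additive : semi_sigma_additive smooth.
Proof.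
exact: (@pushforward_semi_sigma_additive _ _ _ _ _ (mu \x nu)%E _
  measurable_shift).
Qed.

HB.instance Definition _ := isMeasure.Build _ _ _ smooth
  smooth0 smooth_ge0 smooth_sigma_additive.

Let smooth_setT : smooth setT = 1%E.
Proof.
rewrite /smooth /pushforward preimage_setT -setXTT product_measure1E//.
by rewrite -[RHS]mule1; congr (_ * _)%E; exact: probability_setT.
Qed.

HB.instance Definition _ := Measure_isProbability.Build _ _ _ smooth
  smooth_setT.

End smoothing.

Section adapted_wasserstein.
Context (R : realType) (d : nat).
Local Notation E := (d.-tuple R).

Definition bicausal_coupling (P Q : probability (E * E)%type R)
    (pi : probability ((E * E) * (E * E))%type R) : Prop :=
  let X := fun z : (E * E) * (E * E) => z.1.1 in
  let Y := fun z : (E * E) * (E * E) => z.1.2 in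
  let X' := fun z : (E * E) * (E * E) => z.2.1 in
  let Y' := fun z : (E * E) * (E * E) => z.2.2 in
  [/\ forall A, measurable A -> pi (fst @^-1` A) = P A,
      forall A, measurable A -> pi (snd @^-1` A) = Q A,
      same_cond_law pi Y (fun z => (X z, X' z)) X &
      same_cond_law pi Y' (fun z => (X z, X' z)) X'].

Definition AW1 (P Q : probability (E * E)%type R) : \bar R :=
  ereal_inf [set \int[pi]_z (enorm (tsub z.1.2 z.2.2) +
                             enorm (tsub z.1.1 z.2.1))%:E
            | pi in bicausal_coupling P Q]%E.

Definition smoothed_MPD (nu : probability E R) (P : probability (E * E)%type R)
    : \bar R :=
  ereal_inf [set AW1 (smooth P nu) Q
            | Q in [set Q : probability (E * E)%type R |
                     martingale_pair Q fst snd]].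

End adapted_wasserstein.

Section smoothing_density.
Context (R : realType) (d : nat).

Definition C_ (rho : R) : R :=
  (fine (\int[lebesgue_tuple d]_x ((enorm x + 1) `^ (- rho))%:E)%E)^-1.

Definition xi_density (rho sigma : R) (x : d.-tuple R) : R :=
  sigma ^- d * C_ rho * (enorm x / sigma + 1) `^ (- rho).

Definition has_density (nu : probability (d.-tuple R) R) (f : d.-tuple R -> R) :
    Prop :=
  forall A, measurable A -> (nu A = \int[lebesgue_tuple d]_(x in A) (f x)%:E)%E.

End smoothing_density.
Arguments C_ {R} d rho.

(* Main.v *)
Require Import Defs.
From HB Require Import structures.
From mathcomp Require Import all_boot all_order all_algebra.
From mathcomp Require Import all_classical all_reals all_analysis measurable_realfun.
From mathcomp Require Import ring lra.
Set Implicit Arguments.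
Unset Strict Implicit.
Unset Printing Implicit Defensive.
Import Order.TTheory GRing.Theory Num.Theory.
Import numFieldNormedType.Exports.
Local Open Scope classical_set_scope.
Local Open Scope ring_scope.

(** For a sample with atoms (x_i, y_i) put c_i = y_i - x_i, and let f be the density
    of the smoothing variable. The smoothed empirical law is explicit: given that its
    first coordinate is x, the second one is x + c_i with probability proportional
    to f (x - x_i). Subtracting from the second coordinate the conditional mean of the
    increment ([drift]) gives a martingale law, and doing so with the first coordinate
    kept fixed is a bicausal coupling. Its cost bounds the projection distance
    ([smoothed_MPD_le]):

      MPD <= 1/n int sum_j |sum_i c_i^j f (x - x_i)| dx.

    At a fixed x the summands are i.i.d. functions of the sample, and they are centred
    because (X, Y) is a martingale pair ([cond_exp_orthogonal]). So they are
    uncorrelated, and the expectation of the absolute value of their sum is at most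
    sqrt n times the L2 norm of one of them ([iid_sum_L1]).

    That norm is bounded by separating the event |X| > |x|/2, whose probability is
    small by Markov, from its complement, where |x - X| >= |x|/2 makes the density
    small; Hoelder takes out the norm of X^j - Y^j ([weighted_second_moment_le]). The
    result is a multiple of an explicit radial function of x, the [envelope].

    The envelope is integrated over the space. The ball of radius sigma contributes
    its volume, and outside it there are the integrals of |x|^-a for a = p - 1 and
    a = rho, each at most a universal constant times the volume of the unit ball times
    d sigma^(d-a) / (a - d) ([tail_integral_le]). The volume of the unit ball is
    bounded in the dimension, by comparison with a Gaussian ([unit_ball_volume_le]),
    hence a universal L.

    The projection distance is not known to be a measurable function of the sample,
    but the integral of nonnegative functions is monotone without measurability
    ([ge0_le_lower_integral]). *)

(** * Lebesgue measure on tuples *)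

(** A constant of its own, so that a sigma-finite structure can be attached to
    the measure that the recursion on the dimension produces. *)
Definition lebd {R : realType} d : set (d.-tuple R) -> \bar R := @lebesgue_tuple R d.
Arguments lebd {R} d.

HB.instance Definition _ {R : realType} d := Measure.copy (@lebd R d) (@lebesgue_tuple R d).

Section tuple_lebesgue.
Context {R : realType}.
Local Open Scope ereal_scope.

Definition untcons d (x : d.+1.-tuple R) : d.-tuple R * R :=
  ([tuple of behead x], thead x).

Lemma tconsK d : cancel (@tcons R d) (@untcons d).
Proof.
by move=> [x y]; rewrite /untcons /tcons/= theadE; congr pair; apply: val_inj.
Qed.

Lemma measurable_untcons d : measurable_fun setT (@untcons d).
Proof.
apply: measurable_fun_pair; last exact: measurable_tnth.
exact: measurable_behead.
Qed.

(** Products of the two exhausting sequences, read through the inverse of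
    [tcons], exhaust the space of one more dimension. *)
Lemma lebd_sigma_finite d : sigma_finite setT (@lebd R d).
Proof.
elim: d => [|d IH].
  exists (fun=> setT); first by rewrite bigcup_const.
  by move=> k; split => //; rewrite /lebd/= diracT ltry.
pose H := Measure_isSigmaFinite.Build _ _ _ (@lebd R d) IH.
pose m : {sigma_finite_measure set (d.-tuple R) -> \bar R} := HB.pack (@lebd R d) H.
have /sigma_finiteP[F [FT ndF Fm]] := sigma_finiteT m.
have /sigma_finiteP[G [GT ndG Gm]] := sigma_finiteT (@lebesgue_measure R).
exists (fun k => @untcons d @^-1` (F k `*` G k)).
  apply/esym; rewrite -preimage_bigcup -subTset => x _ /=.
  have [n _ Fn] : (\bigcup_i F i) (untcons x).1 by rewrite -FT.
  have [k _ Gk] : (\bigcup_i G i) (untcons x).2 by rewrite -GT.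
  exists (maxn n k) => //; split => /=.
    by move: Fn; exact/subsetPset/ndF/leq_maxl.
  by move: Gk; exact/subsetPset/ndG/leq_maxr.
move=> k; have [mF Foo] := Fm k; have [mG Goo] := Gm k; split.
  by rewrite -[X in measurable X]setTI; apply: measurable_untcons => //; exact: measurableX.
rewrite /lebd/= /lebesgue_tcons/= /pushforward -comp_preimage.
rewrite (_ : _ \o _ = id) ?preimage_id//.
  by rewrite product_measure1E// lte_mul_pinfty// ge0_fin_numE.
by apply/funext => x /=; rewrite tconsK.
Qed.

End tuple_lebesgue.

HB.instance Definition _ {R : realType} d :=
  Measure_isSigmaFinite.Build _ _ _ (@lebd R d) (@lebd_sigma_finite R d).

Section tuple_lebesgue_integral.
Context {R : realType}.
Local Open Scope ereal_scope.

Lemma ge0_integral_lebdS d (F : d.+1.-tuple R -> \bar R) :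
  measurable_fun setT F -> (forall x, 0 <= F x) ->
  \int[lebd d.+1]_x F x =
  \int[lebd d]_x \int[lebesgue_measure]_y F (tcons (x, y)).
Proof.
move=> mF F0.
rewrite (_ : @lebd R d.+1 = pushforward (@lebd R d \x lebesgue_measure) (@tcons R d)) //.
have mt : @measurable_fun _ _ (d.-tuple R * measurableTypeR R)%type _ setT (@tcons R d).
  exact: measurable_tcons.
rewrite (ge0_integral_pushforward mt)//.
rewrite preimage_setT fubini_tonelli1//.
  exact: (measurableT_comp mF mt).
by move=> x /=; exact: F0.
Qed.

Definition affine d (c : d.-tuple R) (t : R) (x : d.-tuple R) : d.-tuple R :=
  [tuple tnth c i + t * tnth x i | i < d]%R.

Lemma measurable_affine d (c : d.-tuple R) t : measurable_fun setT (affine c t).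
Proof.
apply/measurable_fun_tnthP => i.
apply: (eq_measurable_fun (fun x => tnth c i + t * tnth x i)%R).
  by move=> x _ /=; rewrite tnth_mktuple.
apply: measurable_funD => //; apply: measurable_funM => //; exact: measurable_tnth.
Qed.

(** Lebesgue measure on the line is determined by half-open intervals, and on
    those the rescaled image measure has the right value. *)
Lemma ge0_integral_affine1 (a t : R) (F : R -> \bar R) : (0 < t)%R ->
  measurable_fun setT F -> (forall x, 0 <= F x) ->
  \int[lebesgue_measure]_y F (a + t * y)%R = t^-1%:E * \int[lebesgue_measure]_y F y.
Proof.
move=> t0 mF F0.
pose g : measurableTypeR R -> measurableTypeR R := fun y => (a + t * y)%R.
have mg : measurable_fun setT g.
  by apply: (@measurable_funD _ R) => //; exact: (@measurable_funM _ R).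
pose m : {measure set (measurableTypeR R) -> \bar R} :=
  mscale (NngNum (ltW t0)) (pushforward lebesgue_measure g).
have E : forall A, measurable A -> lebesgue_measure A = m mg A.
  apply: lebesgue_measure_unique => _ [[x y] _ <-].
  rewrite /m/= /mscale/= /pushforward/=.
  have -> : g @^-1` `]x, y] = `]((x - a) / t)%R, ((y - a) / t)%R]%classic.
    by apply/seteqP; split => z;
      rewrite /g/= !in_itv/= ltr_pdivrMr// ler_pdivlMr// ltrBlDl lerBrDl (mulrC z).
  rewrite !lebesgue_measure_itv/= !lte_fin ltr_pM2r ?invr_gt0// ltrD2r.
  case: ifPn => _; last by rewrite mule0.
  by rewrite -!EFinB -EFinM; congr EFin; field; rewrite gt_eqF.
have -> : \int[lebesgue_measure]_y F y = \int[m mg]_y F y.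
  by apply: eq_measure_integral => A mA _; exact: E.
rewrite ge0_integral_mscale//= (ge0_integral_pushforward mg)//=.
by rewrite preimage_setT muleA -EFinM mulVf ?gt_eqF// mul1e.
Qed.

(** Induction on the dimension, one coordinate at a time by Tonelli. With
    [t = 1] this is translation invariance, with [c = 0] it is scaling. *)
Lemma ge0_integral_affine d (c : d.-tuple R) (t : R) (F : d.-tuple R -> \bar R) : (0 < t)%R ->
  measurable_fun setT F -> (forall x, 0 <= F x) ->
  \int[lebd d]_y F (affine c t y) = (t ^- d)%:E * \int[lebd d]_y F y.
Proof.
move=> t0; elim: d => [|d IH] in c F *.
  move=> mF F0; rewrite expr0 invr1 mul1e; apply: eq_integral => x _.
  by congr F; rewrite (tuple0 x) [LHS]tuple0.
move=> mF F0; rewrite !ge0_integral_lebdS//; last first.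
  exact: measurableT_comp mF (measurable_affine _ _).
have cE x y : affine c t (tcons (x, y)) =
    tcons (affine [tuple of behead c] t x, thead c + t * y)%R.
  rewrite /affine /tcons/=; apply: eq_from_tnth => i.
  rewrite tnth_mktuple; case: (unliftP ord0 i) => [j|] ->.
    by rewrite !tnthS tnth_mktuple; congr (_ + _)%R; rewrite [in LHS](tuple_eta c) tnthS.
  by rewrite !tnth0.
have mFt : @measurable_fun _ _ (d.-tuple R * measurableTypeR R)%type _ setT (fun z => F (tcons z)).
  exact: measurableT_comp mF (@measurable_tcons R d).
transitivity (\int[lebd d]_x (t^-1%:E * \int[lebesgue_measure]_y
    F (tcons (affine [tuple of behead c] t x, y)))).
  apply: eq_integral => x _; under eq_integral do rewrite cE.
  apply: (@ge0_integral_affine1 _ _ (fun y => F (tcons (_, y)))) => //.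
  exact: measurableT_comp mFt (pair1_measurable _).
have mG : measurable_fun setT (fun x => \int[lebesgue_measure]_y F (tcons (x, y))).
  exact: (@measurable_fun_fubini_tonelli_F _ _ _ _ _ lebesgue_measure
    (fun z => F (tcons z)) mFt (fun=> F0 _)).
rewrite ge0_integralZl_EFin; last 4 first.
- exact: measurableT.
- by move=> x _; apply: integral_ge0 => y _; exact: F0.
- exact: measurableT_comp mG (measurable_affine _ _).
- by rewrite invr_ge0 ltW.
rewrite (IH _ (fun x => \int[lebesgue_measure]_y F (tcons (x, y))))//; last first.
  by move=> x; apply: integral_ge0 => y _; exact: F0.
by rewrite muleA -EFinM -invfM exprSr mulrC.
Qed.

End tuple_lebesgue_integral.

(** * Volume of Euclidean balls and annuli *)

Section euclid.
Context {R : realType}.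
Implicit Types d : nat.

Lemma measurable_sqrt : measurable_fun [set: R] (@Num.sqrt R).
Proof. by apply: continuous_measurable_fun; exact: sqrt_continuous. Qed.

Lemma measurable_enorm d : measurable_fun setT (@enorm R d).
Proof.
apply: measurableT_comp; first exact: measurable_sqrt.
by apply: measurable_sum => i; apply: measurable_funX; exact: measurable_tnth.
Qed.

Lemma enorm_ge0 d (x : d.-tuple R) : 0 <= enorm x.
Proof. exact: sqrtr_ge0. Qed.

Lemma sqr_enorm d (x : d.-tuple R) : enorm x ^+ 2 = \sum_(i < d) tnth x i ^+ 2.
Proof. by rewrite sqr_sqrtr// sumr_ge0// => i _; exact: sqr_ge0. Qed.

Lemma sum_sqr_le (I : Type) (r : seq I) (f : I -> R) :
  \sum_(i <- r) f i ^+ 2 <= (\sum_(i <- r) `|f i|) ^+ 2.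
Proof.
elim: r => [|i r IH]; first by rewrite !big_nil expr0n.
rewrite !big_cons sqrrD real_normK ?num_real// -addrA lerD2l.
rewrite (le_trans IH)// lerDr mulrn_wge0// mulr_ge0//.
exact: sumr_ge0.
Qed.

Lemma enorm_le_sum d (x : d.-tuple R) : enorm x <= \sum_(i < d) `|tnth x i|.
Proof.
rewrite -(@ler_pXn2r _ 2) ?nnegrE ?enorm_ge0//; last exact: sumr_ge0.
by rewrite sqr_enorm; exact: sum_sqr_le.
Qed.

Lemma abs_tnth_le_enorm d (x : d.-tuple R) i : `|tnth x i| <= enorm x.
Proof.
rewrite -(@ler_pXn2r _ 2) ?nnegrE ?enorm_ge0// sqr_enorm real_normK ?num_real//.
by rewrite (bigD1 i)//= lerDl sumr_ge0// => j _; exact: sqr_ge0.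
Qed.

Definition tzero d : d.-tuple R := [tuple 0 | i < d].

Lemma enorm_scale d t (x : d.-tuple R) : 0 <= t ->
  enorm (affine (tzero d) t x) = t * enorm x.
Proof.
move=> t0; rewrite /enorm -[X in X * _](ger0_norm t0) -sqrtr_sqr -sqrtrM ?sqr_ge0//.
rewrite mulr_sumr; congr Num.sqrt; apply: eq_bigr => i _.
by rewrite !tnth_mktuple add0r exprMn.
Qed.

Definition eball d (r : R) : set (d.-tuple R) := [set x | enorm x <= r].

Lemma in_eball d r (x : d.-tuple R) : (x \in eball r) = (enorm x <= r).
Proof. exact: asboolb. Qed.

Lemma measurable_eball d (r : R) : measurable (@eball d r).
Proof.
rewrite -[X in measurable X]setTI (_ : eball _ = @enorm R d @^-1` `]-oo, r]).
  exact: measurable_enorm.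
by apply/seteqP; split => x /=; rewrite in_itv.
Qed.

Lemma measurable_enorm_gt d (r : R) : measurable [set x : d.-tuple R | r < enorm x].
Proof.
rewrite -[X in measurable X]setTI (_ : [set x | _] = @enorm R d @^-1` `]r, +oo[).
  exact: measurable_enorm.
by apply/seteqP; split => x /=; rewrite in_itv/= andbT.
Qed.

(** The normal density of variance 1 / (2 pi) has peak value 1. *)
Lemma gauss1 : (\int[lebesgue_measure]_y (expR (- (pi * y ^+ 2)))%:E = 1 :> \bar R)%E.
Proof.
pose s : R := Num.sqrt ((pi *+ 2)^-1).
have p0 : 0 < pi *+ 2 :> R by rewrite mulrn_wgt0// pi_gt0.
have s2 : s ^+ 2 = (pi *+ 2)^-1 by rewrite sqr_sqrtr// invr_ge0 ltW.
have s0 : s != 0 by rewrite gt_eqF// sqrtr_gt0 invr_gt0.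
rewrite -(@integral_normal_pdf R 0 s); apply: eq_integral => x _.
rewrite normal_pdfE// /normal_peak /normal_fun s2 subr0; congr EFin.
rewrite (_ : _ * pi *+ 2 = 1); last first.
  by rewrite -mulrnAr mulVf ?gt_eqF.
rewrite sqrtr1 invr1 mul1r; congr expR.
have -> : (pi *+ 2)^-1 *+ 2 = pi^-1 :> R.
  by rewrite -mulr_natr -[pi *+ 2]mulr_natr invfM mulfVK// pnatr_eq0.
by rewrite invrK mulNr mulrC.
Qed.

Lemma measurable_gaussd d :
  measurable_fun setT (fun x : d.-tuple R => expR (- (pi * \sum_(i < d) tnth x i ^+ 2))).
Proof.
apply: measurableT_comp => //; apply: measurable_funN; apply: measurable_funM => //.
by apply: measurable_sum => i; apply: measurable_funX; exact: measurable_tnth.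
Qed.

Lemma gaussd d : (\int[lebd d]_x (expR (- (pi * \sum_(i < d) tnth x i ^+ 2)))%:E = 1 :> \bar R)%E.
Proof.
elim: d => [|d IH].
  rewrite integral_dirac// ?diracT ?mul1e ?big_ord0 ?mulr0 ?oppr0 ?expR0//.
  by apply/measurable_EFinP; exact: measurable_gaussd.
rewrite ge0_integral_lebdS//; last first.
  by apply/measurable_EFinP; exact: measurable_gaussd.
rewrite -[RHS]IH; apply: eq_integral => x _.
transitivity (\int[lebesgue_measure]_y
    ((expR (- (pi * \sum_(i < d) tnth x i ^+ 2)))%:E * (expR (- (pi * y ^+ 2)))%:E))%E.
  apply: eq_integral => y _; rewrite -EFinM -expRD; congr (expR _)%:E.
  rewrite -opprD -mulrDr [in RHS]addrC big_ord_recl tnth0; congr (- (_ * (_ + _))).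
  by apply: eq_bigr => i _; rewrite tnthS.
rewrite ge0_integralZl_EFin//.
- by rewrite gauss1 mule1.
- apply/measurable_EFinP; apply: measurableT_comp => //; apply: measurable_funN.
  by apply: measurable_funM => //; exact: measurable_funX.
Qed.

(** The ball is dominated by exp pi times the Gaussian density
    exp (- pi |x|^2), whose total mass is 1 in every dimension: this is where
    the final constant becomes independent of the dimension. *)
Lemma lebd_unit_ball_le d : (lebd d (eball 1%R) <= (expR pi)%:E)%E.
Proof.
rewrite -[X in lebd d X]setIT -integral_indic//; last exact: measurable_eball.
rewrite -[leRHS]mule1 -(gaussd d) -ge0_integralZl_EFin//; last first.
  by apply/measurable_EFinP; exact: measurable_gaussd.
apply: ge0_le_integral => //.
- by apply/measurable_EFinP; apply: measurable_indic; exact: measurable_eball.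
- by apply/measurable_EFinP; apply: measurable_funM => //; exact: measurable_gaussd.
move=> x _; rewrite -EFinM lee_fin indicE -expRD.
case: (boolP (x \in _)) => [|_]; last exact: expR_ge0.
rewrite inE/= => x1; rewrite -expR0 ler_expR -sqr_enorm subr_ge0.
by rewrite ler_piMr ?pi_ge0// expr_le1// enorm_ge0.
Qed.

Definition unit_ball_volume d : R := fine (lebd d (eball 1%R)).

Lemma lebd_unit_ball d : lebd d (eball 1%R) = (unit_ball_volume d)%:E.
Proof.
by rewrite fineK// ge0_fin_numE// (le_lt_trans (lebd_unit_ball_le d))// ltry.
Qed.

Lemma unit_ball_volume_le d : unit_ball_volume d <= expR pi.
Proof. by rewrite -lee_fin -lebd_unit_ball; exact: lebd_unit_ball_le. Qed.

Lemma unit_ball_volume_ge0 d : 0 <= unit_ball_volume d.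
Proof. by rewrite fine_ge0. Qed.

Lemma lebd_dilate d t (F : d.-tuple R -> \bar R) : 0 < t ->
  measurable_fun setT F -> (forall x, 0 <= F x)%E ->
  (\int[lebd d]_x F x = (t ^+ d)%:E * \int[lebd d]_x F (affine (tzero d) t x))%E.
Proof.
move=> t0 mF F0; rewrite ge0_integral_affine// muleA -EFinM divff ?mul1e//.
by rewrite expf_neq0// gt_eqF.
Qed.

Lemma lebd_ball d r : 0 < r ->
  lebd d (@eball d r) = (r ^+ d * unit_ball_volume d)%:E.
Proof.
move=> r0; rewrite -[X in lebd d X]setIT -integral_indic//; last exact: measurable_eball.
rewrite (lebd_dilate r0)//; last first.
  by apply/measurable_EFinP; apply: measurable_indic; exact: measurable_eball.
rewrite EFinM -lebd_unit_ball; congr (_ * _)%E.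
rewrite -[X in lebd d X]setIT -integral_indic//; last exact: measurable_eball.
apply: eq_integral => x _; rewrite !indicE; congr ((nat_of_bool _)%:R)%:E.
by rewrite !in_eball enorm_scale ?(ltW r0)// -[X in _ <= X]mulr1 ler_pM2l.
Qed.

Definition annulus d (r s : R) : set (d.-tuple R) := [set x | r < enorm x <= s].

Lemma measurable_annulus d r s : measurable (@annulus d r s).
Proof.
rewrite (_ : annulus _ _ = [set x | r < enorm x] `&` eball s).
  by apply: measurableI; [exact: measurable_enorm_gt|exact: measurable_eball].
by apply/seteqP; split => x /=; [move/andP => []|case=> rx xs; exact/andP].
Qed.

Lemma lebd_annulus d r s : 0 < r -> r <= s ->
  lebd d (@annulus d r s) = ((s ^+ d - r ^+ d) * unit_ball_volume d)%:E.
Proof.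
move=> r0 rs; have s0 := lt_le_trans r0 rs.
rewrite (_ : annulus _ _ = eball s `\` eball r).
  rewrite measureD//; [|exact: measurable_eball|exact: measurable_eball|
    by rewrite /= lebd_ball// ltry].
  rewrite setIidr; last by move=> x /= /le_trans; apply.
  by rewrite /= !lebd_ball// mulrBl.
apply/seteqP; split => x /=.
  by move=> /andP[rx xs]; split => //; apply/negP; rewrite -ltNge.
by move=> [xs /negP]; rewrite -ltNge => rx; apply/andP.
Qed.

Lemma measurable_powR_enorm d (a : R) : measurable_fun setT (fun x : d.-tuple R => enorm x `^ a).
Proof. exact: measurableT_comp (measurable_powR _) (@measurable_enorm d). Qed.

(** With [z = d / a] this compares the volume [expR z - 1] of a thin shell with
    the gain [1 - expR (z - 1)] of one dilation by [expR a^-1]. The bound is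
    linear in [z / (1 - z) = d / (a - d)], uniformly in [d] and [a]; the dyadic
    dilation would lose that for [a] much larger than [d]. *)
Lemma geometric_factor_le (a z : R) : 0 < z < 1 ->
  expR z - 1 <= 2 * expR 1 * z / (1 - z) * (1 - expR (z - 1)).
Proof.
move=> /andP[z0 z1].
have e1 : expR z - 1 <= z * expR 1.
  rewrite (@le_trans _ _ (z * expR z))//; last by rewrite ler_pM2l// ler_expR ltW.
  rewrite lerBlDr -lerBlDl -[X in X - _]mul1r -mulrBl mulrC.
  rewrite -ler_pdivlMl ?expR_gt0// mulr1 -expRN; exact: expR_ge1Dx.
have e2 : (1 - z) / 2 <= 1 - expR (z - 1).
  have w0 := expR_gt0 (z - 1).
  have : expR (z - 1) * (1 + (1 - z)) <= 1.
    rewrite -[leRHS](expRxMexpNx_1 (z - 1)) ler_pM2l// opprB.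
    exact: expR_ge1Dx.
  set w := expR _ in w0 * => H; rewrite ler_pdivrMr//; nra.
rewrite (le_trans e1)//.
rewrite [leRHS](_ : _ = z * expR 1 * (2 * (1 - expR (z - 1)) / (1 - z))); last by ring.
rewrite -[leLHS]mulr1 ler_pM2l ?mulr_gt0 ?expR_gt0// ler_pdivlMr ?subr_gt0// mul1r.
by move: e2; rewrite ler_pdivrMr// mulrC.
Qed.

End euclid.

(** * Integral of a power of the norm outside a ball *)

Section tail.
Context {R : realType}.
Variables (d : nat) (a r : R).
Hypotheses (d0 : (0 < d)%N) (da : d%:R < a) (r0 : 0 < r).
Local Notation E := (d.-tuple R).

Let a0 : 0 < a. Proof. by rewrite (lt_trans _ da)// ltr0n. Qed.

Let f (x : E) : \bar R := (enorm x `^ (- a))%:E.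

Let mf : measurable_fun setT f.
Proof. by apply/measurable_EFinP; exact: measurable_powR_enorm. Qed.

Let f_ge0 x : (0 <= f x)%E. Proof. by rewrite lee_fin powR_ge0. Qed.

Let annulus_le s : r <= s ->
  (\int[lebd d]_(x in annulus r s) f x <=
   (r `^ (- a) * ((s ^+ d - r ^+ d) * unit_ball_volume d))%:E)%E.
Proof.
move=> rs; rewrite EFinM -(lebd_annulus d r0 rs) -integral_cst//; last exact: measurable_annulus.
apply: ge0_le_integral => //.
- exact: measurable_annulus.
- exact: measurable_funTS.
move=> x /andP[rx _]; rewrite lee_fin !powRN lef_pV2 ?posrE ?powR_gt0//; last exact: lt_trans rx.
by apply: ge0_ler_powR; rewrite ?nnegrE ?enorm_ge0//; exact/ltW.
Qed.

(** The integrand is homogeneous of degree [- a]. *)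
Let dilate_annulus t s : 0 < t ->
  (\int[lebd d]_(x in annulus (t * r) (t * s)) f x =
   (t `^ (d%:R - a))%:E * \int[lebd d]_(x in annulus r s) f x)%E.
Proof.
move=> t0; have t0' := ltW t0.
rewrite integral_mkcond (lebd_dilate t0); last 2 first.
- by apply/(measurable_restrictT _ _).1; [exact: measurable_annulus|exact: measurable_funTS].
- by move=> x; rewrite patchE; case: ifP.
have -> : t `^ (d%:R - a) = t ^+ d * t `^ (- a).
  by rewrite powRD ?(gt_eqF t0) ?implybT// powR_mulrn.
rewrite EFinM -muleA; congr (_ * _)%E.
rewrite [in RHS]integral_mkcond -ge0_integralZl_EFin ?powR_ge0//; last 2 first.
- by move=> x _; rewrite patchE; case: ifP.
- by apply/(measurable_restrictT _ _).1; [exact: measurable_annulus|exact: measurable_funTS].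
apply: eq_integral => x _; rewrite !patchE.
have -> : (affine (tzero d) t x \in annulus (t * r) (t * s)) = (x \in annulus r s).
  rewrite /annulus/=; rewrite [LHS]asboolb [RHS]asboolb.
  by rewrite enorm_scale// ltr_pM2l// ler_pM2l.
case: ifP => _; last by rewrite mule0.
by rewrite /f enorm_scale// powRM// ?enorm_ge0// EFinM.
Qed.

Definition tail_bound : R :=
  2 * expR 1 * unit_ball_volume d * (d%:R / (a - d%:R)) * r `^ (d%:R - a).

(** Dilation by [t] maps the annulus from [r] to [s] onto the one from [t * r] to
    [t * s], which covers it together with the shell from [r] to [t * r]. So the
    integral J satisfies J <= shell + t^(d-a) J, and as J is finite this bounds it
    uniformly in [s]. *)
Let annulus_bound s : r <= s -> (\int[lebd d]_(x in annulus r s) f x <= tail_bound%:E)%E.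
Proof.
move=> rs; set J := (X in (X <= _)%E).
have J0 : (0 <= J)%E by apply: integral_ge0.
have Jfin : J \is a fin_num.
  by rewrite ge0_fin_numE// (le_lt_trans (annulus_le rs))// ltry.
pose z := d%:R / a; pose t := expR (a^-1).
have z01 : 0 < z < 1 by rewrite /z divr_gt0 ?ltr0n// ltr_pdivrMr ?mul1r.
have t1 : 1 <= t by rewrite -expR0 ler_expR invr_ge0 ltW.
have t0 : 0 < t := expR_gt0 _.
have td : t ^+ d = expR z by rewrite -expRM_natl.
have tda : t `^ (d%:R - a) = expR (z - 1).
  by rewrite -expRM mulrBr mulVf ?gt_eqF// mulrC.
have H : (J <= (r `^ (- a) * (((t * r) ^+ d - r ^+ d) * unit_ball_volume d))%:E +
    (t `^ (d%:R - a))%:E * J)%E.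
  rewrite -dilate_annulus//.
  apply: (@le_trans _ _
    (\int[lebd d]_(x in annulus r (t * r) `|` annulus (t * r) (t * s)) f x)%E).
    apply: ge0_subset_integral => //.
    - exact: measurable_annulus.
    - by apply: measurableU; exact: measurable_annulus.
    - exact: measurable_funTS.
    move=> x /andP[rx xs] /=; have [xt|xt] := leP (enorm x) (t * r).
      by left; rewrite /annulus/= rx.
    by right; rewrite /annulus/= xt (le_trans xs)// ler_peMl// (le_trans _ rs)// ltW.
  rewrite ge0_integral_setU//.
  - by rewrite leeD2r// annulus_le// ler_peMl// ltW.
  - exact: measurable_annulus.
  - exact: measurable_annulus.
  - exact: measurable_funTS.
  - rewrite disj_set2E; apply/eqP; rewrite -subset0 => x [] /andP[_ xt] /andP[+ _].
    by rewrite ltNge xt.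
rewrite -(fineK Jfin) tda -EFinM -EFinD lee_fin in H.
rewrite -(fineK Jfin) lee_fin; set j := fine J in H *.
have z1 : 0 < 1 - z by case/andP: z01; rewrite subr_gt0.
have e1 : 0 < 1 - expR (z - 1) by rewrite subr_gt0 expR_lt1 subr_lt0; case/andP: z01.
have {}H : j * (1 - expR (z - 1)) <= r `^ (d%:R - a) * unit_ball_volume d * (expR z - 1).
  move: H; rewrite exprMn td powRD ?(gt_eqF r0) ?implybT// powR_mulrn ?(ltW r0)//.
  set X := r `^ _; set Y := r ^+ d; set e := expR (z - 1); lra.
have -> : tail_bound = r `^ (d%:R - a) * unit_ball_volume d * (2 * expR 1 * z / (1 - z)).
  rewrite /tail_bound /z; field; rewrite gt_eqF//= ?subr_gt0// gt_eqF ?subr_gt0//.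
rewrite -(ler_pM2r e1) (le_trans H)// -[leRHS]mulrA.
apply: ler_wpM2l; first by rewrite mulr_ge0 ?powR_ge0 ?unit_ball_volume_ge0.
exact: geometric_factor_le.
Qed.

Lemma tail_integral_le :
  (\int[lebd d]_(x in ~` eball r) f x <= tail_bound%:E)%E.
Proof.
pose g n := f \_ (annulus r (r + n%:R)).
have mg n : measurable_fun setT (g n).
  by apply/(measurable_restrictT _ _).1; [exact: measurable_annulus|exact: measurable_funTS].
have g0 n x : setT x -> (0 <= g n x)%E by move=> _; rewrite /g patchE; case: ifP.
have ndg x : setT x -> {homo g^~ x : n m / (n <= m)%N >-> (n <= m)%E}.
  move=> _ n m nm; rewrite /g !patchE; case: ifPn => [|_]; last by case: ifP.
  rewrite inE => /andP[rx xn]; rewrite ifT// inE/= /annulus/= rx (le_trans xn)//.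
  by rewrite lerD2l ler_nat.
have := cvg_monotone_convergence measurableT mg g0 ndg => /(_ (lebd d)).
have -> : (\int[lebd d]_x limn (g^~ x) = \int[lebd d]_(x in ~` eball r) f x)%E.
  rewrite [RHS]integral_mkcond; apply: eq_integral => x _; rewrite patchE.
  rewrite in_setC in_eball -ltNge; case: ifPn => [rx|].
    apply/cvg_lim => //; apply: cvg_near_cst.
    exists (Num.bound (enorm x)) => // n /= nx; rewrite /g patchE ifT// inE/= /annulus/= rx.
    have xn : enorm x <= n%:R.
      by rewrite (le_trans (ltW (archi_boundP (enorm_ge0 x))))// ler_nat.
    by rewrite ler_wpDl// ltW.
  rewrite -leNgt => xr; rewrite (_ : g^~ x = cst point) ?lim_cst//.
  apply/funext => n; rewrite /g patchE ifF//.
  by apply/negbTE; apply/negP; rewrite inE /annulus/= ltNge xr.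
move=> cv; rewrite -(cvg_lim _ cv)//; apply: lime_le; first by apply/cvg_ex; eexists; exact: cv.
apply: nearW => n; rewrite /g -integral_mkcond annulus_bound// lerDl//.
Qed.

End tail.

(** * Integration against densities and empirical measures *)

Section integration.
Local Open Scope ereal_scope.

(** No measurability is assumed: the integral of a nonnegative function is a
    supremum over the simple functions below it. The projection distance, an
    infimum over uncountably many laws, is integrated in this sense. *)
Lemma ge0_le_lower_integral d (T : measurableType d) (R : realType)
    (mu : {measure set T -> \bar R}) (f g : T -> \bar R) :
  (forall x, 0 <= f x) -> (forall x, f x <= g x) ->
  \int[mu]_x f x <= \int[mu]_x g x.
Proof.
move=> f0 fg; have g0 x : 0 <= g x by exact: le_trans (f0 x) (fg x).
rewrite !ge0_integralTE//; apply: le_ereal_sup => _ [h hf <-].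
by exists h => // x; exact: le_trans (hf x) (fg x).
Qed.

Import HBNNSimple.

(** Both sides are limits along simple approximations of [F]. *)
Lemma ge0_integral_density d (T : measurableType d) (R : realType)
    (mu nu : {measure set T -> \bar R}) (f : T -> R) :
  measurable_fun setT f -> (forall x, (0 <= f x)%R) ->
  (forall A, measurable A -> nu A = \int[mu]_(x in A) (f x)%:E) ->
  forall F : T -> \bar R, measurable_fun setT F -> (forall x, 0 <= F x) ->
  \int[nu]_x F x = \int[mu]_x (F x * (f x)%:E).
Proof.
move=> mf f0 nuE F mF F0.
pose F_ := nnsfun_approx measurableT mF.
have F_cvg x : (F_ n x)%:E @[n --> \oo] --> F x by apply: cvg_nnsfun_approx.
have F_nd x : {homo (fun n => (F_ n x)%:E) : n m / (n <= m)%N >-> n <= m}.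
  by move=> n m nm; rewrite lee_fin; exact/lefP/nd_nnsfun_approx.
transitivity (limn (fun n => \int[nu]_x (F_ n x)%:E)).
  rewrite -monotone_convergence//.
  - by apply: eq_integral => x _; apply/esym/cvg_lim.
  - by move=> n; exact/measurable_EFinP/measurable_funP.
  - by move=> n x _; rewrite lee_fin.
transitivity (limn (fun n => \int[mu]_x ((F_ n x)%:E * (f x)%:E))); last first.
  rewrite -monotone_convergence//.
  - apply: eq_integral => x _; apply/cvg_lim => //.
    by apply: cvgeZr => //.
  - by move=> n; apply/measurable_EFinP/measurable_funM.
  - by move=> n x _; rewrite mule_ge0 ?lee_fin.
  - by move=> x _ n m nm; rewrite lee_pmul ?lee_fin//; exact/lefP/nd_nnsfun_approx.
congr (limn _); apply/funext => n.
rewrite integralT_nnsfun sintegralE.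
have mpre r : measurable (F_ n @^-1` [set r]) by [].
transitivity (\sum_(x \in range (F_ n)) \int[mu]_y (x * \1_(F_ n @^-1` [set x]) y * f y)%:E).
  apply: eq_fsbigr => r; rewrite inE => -[y _ yr].
  have r0 : (0 <= r)%R by rewrite -yr.
  rewrite nuE// integral_mkcond -ge0_integralZl_EFin//.
  - apply: eq_integral => x _; rewrite patchE -mulrA EFinM; congr (_ * _).
    by rewrite indicE; case: ifP => _; rewrite ?mul1r ?mul0r.
  - by move=> x _; rewrite patchE; case: ifP; rewrite ?lee_fin.
  - apply/(measurable_restrictT _ _).1 => //.
    exact/measurable_funTS/measurable_EFinP.
rewrite -ge0_integral_fsum//.
- apply: eq_integral => x _; rewrite [in RHS]fimfunE fsumEFin// -EFinM.
  by congr EFin; rewrite mulrC mulr_fsumr//; apply: eq_fsbigr => r _; rewrite mulrC.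
- move=> r; apply/measurable_EFinP; apply: measurable_funM => //.
  by apply: measurable_funM => //; exact: measurable_indic.
- move=> r x rD; rewrite lee_fin mulr_ge0//; exact: nnfun_muleindic_ge0.
Qed.

Lemma ge0_integral_empirical d (T : measurableType d) (R : realType) n
    (s : 'I_n -> T) (n0 : (0 < n)%N) (F : T -> \bar R) :
  measurable_fun setT F -> (forall x, 0 <= F x) ->
  \int[empirical s n0]_x F x = (n%:R^-1)%:E * \sum_(i < n) F (s i).
Proof.
move=> mF F0.
pose m (k : nat) : {measure set T -> \bar R} :=
  if insub k is Some i then dirac (s i) else mzero.
have n_inv_ge0 : (0 <= n%:R^-1 :> R)%R by rewrite invr_ge0.
have -> : \int[empirical s n0]_x F x = \int[mscale (NngNum n_inv_ge0) (msum m n)]_x F x.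
  apply: eq_measure_integral => A _ _; rewrite /empirical /mscale/= /msum.
  by congr (_ * _); apply: eq_bigr => i _; rewrite /m valK.
rewrite ge0_integral_mscale//= ge0_integral_measure_sum//.
congr (_ * _); apply: eq_bigr => i _.
by rewrite /m valK integral_dirac// diracT mul1e.
Qed.

End integration.

(** * Martingale projection of a smoothed empirical measure *)

Section mixture_kernel.
Context d1 d2 (U : measurableType d1) (V : measurableType d2) (R : realType).
Variables (n : nat) (p : 'I_n -> U -> R) (phi : 'I_n -> U -> V).
Hypotheses (mp : forall i, measurable_fun setT (p i))
  (mphi : forall i, measurable_fun setT (phi i))
  (p0 : forall i u, 0 <= p i u) (p1 : forall u, \sum_(i < n) p i u = 1).

Let m u (k : nat) : {measure set V -> \bar R} :=
  if insub k is Some i then mscale (NngNum (p0 i u)) (dirac (phi i u)) else mzero.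

Definition mixture (u : U) : {measure set V -> \bar R} := msum (m u) n.

Lemma mixtureE u B : mixture u B = (\sum_(i < n) (p i u)%:E * \d_(phi i u) B)%E.
Proof. by apply: eq_bigr => i _; rewrite /m valK. Qed.

Let mixture_measurable B : measurable B -> measurable_fun setT (mixture ^~ B).
Proof.
move=> mB; apply: (eq_measurable_fun (fun u => \sum_(i < n) (p i u)%:E * \d_(phi i u) B)%E).
  by move=> u _; rewrite mixtureE.
apply: emeasurable_sum => i; apply: emeasurable_funM; first exact/measurable_EFinP.
exact: measurableT_comp (measurable_fun_dirac mB) (mphi i).
Qed.

HB.instance Definition _ := isKernel.Build _ _ _ _ _ mixture mixture_measurable.

Let mixture_prob u : mixture u setT = 1%E.
Proof.
rewrite mixtureE; under eq_bigr do rewrite diracT mule1.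
by rewrite sumEFin p1.
Qed.

HB.instance Definition _ := Kernel_isProbability.Build _ _ _ _ _ mixture mixture_prob.

Lemma mixture_kernel_exists : exists k : R.-pker U ~> V,
  forall u B, k u B = (\sum_(i < n) p i u * \1_B (phi i u))%:E.
Proof.
exists mixture => u B; rewrite mixtureE -sumEFin; apply: eq_bigr => i _.
by rewrite EFinM diracE indicE.
Qed.

End mixture_kernel.

Section projection.
Context {R : realType} {d : nat}.
Local Notation E := (d.-tuple R).
Variables (n : nat) (n0 : (0 < n)%N) (s : 'I_n -> E * E).
Variables (f : E -> R) (nu : probability E R).
Hypotheses (mf : measurable_fun setT f) (f0 : forall x, 0 < f x)
  (nuE : forall A, measurable A -> (nu A = \int[lebd d]_(x in A) (f x)%:E)%E)
  (nu1 : forall j : 'I_d, (\int[nu]_x `|tnth x j|%:E < +oo)%E).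

Definition increment i : E := tsub (s i).2 (s i).1.
Definition jump i (x : E) : E := tadd x (increment i).
Definition weight i (x : E) : R := f (tsub x (s i).1).
Definition total_weight x := \sum_(i < n) weight i x.
Let Pt : probability (E * E)%type R := smooth (empirical s n0) nu.

Lemma measurable_tsub dT (T : measurableType dT) (a b : T -> E) :
  measurable_fun setT a -> measurable_fun setT b ->
  measurable_fun setT (fun x => tsub (a x) (b x)).
Proof.
move=> ma mb; apply/measurable_fun_tnthP => i.
apply: (eq_measurable_fun (fun x => tnth (a x) i - tnth (b x) i)).
  by move=> x _ /=; rewrite tnth_mktuple.
by apply: measurable_funB; apply: measurableT_comp (@measurable_tnth _ _ _ i) _.
Qed.

Let mjump i : measurable_fun setT (jump i).
Proof. exact: measurable_tadd. Qed.

Let mw i : measurable_fun setT (weight i).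
Proof. by apply: measurableT_comp mf _; exact: measurable_tsub. Qed.

Let w_gt0 i x : 0 < weight i x. Proof. exact: f0. Qed.

Let w_ge0 i x : 0 <= weight i x. Proof. exact: ltW. Qed.

Let mS : measurable_fun setT total_weight. Proof. exact: measurable_sum. Qed.

Let S_gt0 x : 0 < total_weight x.
Proof.
rewrite /total_weight (bigD1 (Ordinal n0))//= ltr_wpDr//.
by apply: sumr_ge0 => i _.
Qed.

Let S_neq0 x : total_weight x != 0. Proof. by rewrite gt_eqF. Qed.

Let measurable_Sinv : measurable_fun setT (fun x => (total_weight x)^-1).
Proof.
apply: (eq_measurable_fun (fun x => total_weight x `^ (-1))).
  by move=> x _; rewrite powR_inv1// ltW.
exact: measurableT_comp (measurable_powR _) mS.
Qed.

(** Given its first coordinate [x], the smoothed law puts the second one at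
    [jump i x] with probability proportional to [weight i x]. *)
Lemma ge0_integral_smooth_empirical (F : E * E -> \bar R) :
  measurable_fun setT F -> (forall z, 0 <= F z)%E ->
  (\int[Pt]_z F z =
   (n%:R^-1)%:E * \sum_(i < n) \int[lebd d]_x (F (x, jump i x) * (weight i x)%:E))%E.
Proof.
move=> mF F0.
have mshift : measurable_fun setT
    (fun z : (E * E) * E => (tadd z.1.1 z.2, tadd z.1.2 z.2)).
  apply: measurable_fun_pair; apply: measurable_tadd => //.
    exact: (measurableT_comp measurable_fst measurable_fst).
  exact: (measurableT_comp measurable_snd measurable_fst).
rewrite /Pt /= /smooth (ge0_integral_pushforward mshift)// preimage_setT.
have mG := measurableT_comp mF mshift.
have G0 x : (0 <= (F \o (fun z : (E * E) * E => (tadd z.1.1 z.2, tadd z.1.2 z.2))) x)%E.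
  exact: F0.
rewrite (fubini_tonelli1 (m1 := empirical s n0) (m2 := nu) _ mG)//.
rewrite ge0_integral_empirical//; last 2 first.
- exact: (measurable_fun_fubini_tonelli_F (m2 := nu) _ mG).
- by move=> z; apply: integral_ge0.
congr (_ * _)%E; apply: eq_bigr => i _.
rewrite /fubini_F /=.
have m1 : measurable_fun setT (fun x => F (x, jump i x)).
  by apply: measurableT_comp mF _; exact: measurable_fun_pair.
rewrite (@ge0_integral_density _ _ _ (lebd d) nu f mf (fun x => ltW (f0 x)) nuE)//; last first.
  apply: measurableT_comp mF _; apply: measurable_fun_pair; exact: measurable_tadd.
have := @ge0_integral_affine R d (s i).1 1 (fun x => F (x, jump i x) * (weight i x)%:E)%E ltr01.
rewrite expr1n invr1 mul1e => <-.
- apply: eq_integral => x _.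
  have -> : affine (s i).1 1 x = tadd (s i).1 x.
    by apply: eq_from_tnth => j; rewrite !tnth_mktuple mul1r.
  congr (F (_, _) * (f _)%:E)%E; apply: eq_from_tnth => j; rewrite !tnth_mktuple; lra.
- by apply: emeasurable_funM => //; exact/measurable_EFinP.
- by move=> x; rewrite mule_ge0// lee_fin.
Qed.

(** The conditional mean of the increment given that the first smoothed
    coordinate is [x]. *)
Definition drift (x : E) : E :=
  [tuple (\sum_(i < n) tnth (increment i) j * weight i x) / total_weight x | j < d].

Let mdrift : measurable_fun setT drift.
Proof.
apply/measurable_fun_tnthP => j.
apply: (eq_measurable_fun
  (fun x => (\sum_(i < n) tnth (increment i) j * weight i x) / total_weight x)).
  by move=> x _ /=; rewrite tnth_mktuple.
apply: measurable_funM; first by apply: measurable_sum => i; exact: measurable_funM.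
exact: measurable_Sinv.
Qed.

Lemma ge0_integral_distribution_smooth dT (T : measurableType dT)
    (psi : {mfun (E * E)%type >-> T}) (F : T -> \bar R) :
  measurable_fun setT F -> (forall z, 0 <= F z)%E ->
  (\int[distribution Pt psi]_z F z =
   (n%:R^-1)%:E * \int[lebd d]_x \sum_(i < n) (F (psi (x, jump i x)) * (weight i x)%:E))%E.
Proof.
move=> mF F0; have mpsi : measurable_fun setT psi by [].
have mFpsi : measurable_fun setT (F \o psi) by exact: measurableT_comp.
rewrite /distribution (ge0_integral_pushforward mpsi)// preimage_setT.
rewrite ge0_integral_smooth_empirical//; last by move=> z; exact: F0.
rewrite ge0_integral_sum//.
- move=> i; apply: emeasurable_funM; last exact/measurable_EFinP.
  by apply: measurableT_comp mFpsi _; exact: measurable_fun_pair.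
- by move=> i x _; rewrite mule_ge0// lee_fin.
Qed.

(** At each [x] the two integrands are weighted sums of the same indicators: the
    total weight cancels the denominator in the kernel. *)
Lemma is_cond_law_smooth dT dU dV (T : measurableType dT) (U : measurableType dU)
    (V : measurableType dV) (psi : {mfun (E * E)%type >-> T}) (X : T -> U)
    (Y : T -> V) (iota : E -> U) (phi : 'I_n -> E -> V) (k : R.-pker U ~> V) :
  measurable_fun setT X -> measurable_fun setT Y ->
  (forall i x, X (psi (x, jump i x)) = iota x) ->
  (forall i x, Y (psi (x, jump i x)) = phi i x) ->
  (forall x B, k (iota x) B = (\sum_(i < n) weight i x / total_weight x * \1_B (phi i x))%:E) ->
  is_cond_law (distribution Pt psi) X Y k.
Proof.
move=> mX mY Xpsi Ypsi kE A B mA mB.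
have mXA : measurable (X @^-1` A) by rewrite -[X in measurable X]setTI; exact: mX.
have mYB : measurable (Y @^-1` B) by rewrite -[X in measurable X]setTI; exact: mY.
have mAB := measurableI _ _ mXA mYB.
transitivity (\int[distribution Pt psi]_z (\1_(X @^-1` A `&` Y @^-1` B) z)%:E)%E.
  by rewrite integral_indic// setIT.
transitivity (\int[distribution Pt psi]_z ((\1_A (X z))%:E * k (X z) B))%E; last first.
  rewrite [RHS]integral_mkcond; apply: eq_integral => z _.
  rewrite patchE indicE (_ : (X z \in A) = (z \in X @^-1` A)); last first.
    by apply/idP/idP; rewrite !inE.
  by case: ifP => _; rewrite ?mul1e ?mul0e.
have mk : measurable_fun setT (fun z => k (X z) B).
  exact: measurableT_comp (measurable_kernel k B mB) mX.
have mi : measurable_fun setT (fun z => (\1_A (X z) : R)).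
  by apply: measurableT_comp mX; exact: measurable_indic.
rewrite !ge0_integral_distribution_smooth//; last 2 first.
- by apply: emeasurable_funM => //; exact/measurable_EFinP.
- by apply/measurable_EFinP; exact: measurable_indic.
congr (_ * _)%E; apply: eq_integral => x _.
transitivity (\sum_(i < n) (\1_A (iota x) * \1_B (phi i x) * weight i x))%:E.
  rewrite -sumEFin; apply: eq_bigr => i _; rewrite -EFinM indicI /=.
  congr (_ * _)%:E; rewrite /= -(Xpsi i) -(Ypsi i) !indicE.
  by congr ((nat_of_bool _)%:R * (nat_of_bool _)%:R); apply/idP/idP; rewrite !inE.
under [RHS]eq_bigr do rewrite Xpsi kE -!EFinM.
rewrite sumEFin; congr EFin; rewrite -mulr_sumr -/(total_weight x) -mulrA.
rewrite [X in _ * X]mulr_suml mulr_sumr.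
by apply: eq_bigr => i _; field; exact: S_neq0.
Qed.

(** Observing two copies of the first coordinate tells no more than one; [sel]
    picks the copy that [X2] observes. Both causality conditions are instances. *)
Lemma same_cond_law_smooth dT dV (T : measurableType dT)
    (V : measurableType dV) (psi : {mfun (E * E)%type >-> T}) (X1 : T -> E * E)
    (X2 : T -> E) (Y : T -> V) (phi : 'I_n -> E -> V) (sel : E * E -> E) :
  measurable_fun setT X1 -> measurable_fun setT sel -> measurable_fun setT Y ->
  (forall i, measurable_fun setT (phi i)) ->
  (forall z, X2 z = sel (X1 z)) -> (forall x, sel (x, x) = x) ->
  (forall i x, X1 (psi (x, jump i x)) = (x, x)) ->
  (forall i x, Y (psi (x, jump i x)) = phi i x) ->
  same_cond_law (distribution Pt psi) Y X1 X2.
Proof.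
move=> mX1 msel mY mphi X2E selE X1psi Ypsi.
have mp i : measurable_fun setT (fun x => weight i x / total_weight x) by exact: measurable_funM.
have p0 i x : 0 <= weight i x / total_weight x by rewrite divr_ge0// ltW.
have p1 x : \sum_(i < n) weight i x / total_weight x = 1.
  by rewrite -mulr_suml -/(total_weight x) divff.
have [k2 k2E] := mixture_kernel_exists mp mphi p0 p1.
have [k1 k1E] := @mixture_kernel_exists _ _ (E * E)%type _ _ n
  (fun i u => weight i (sel u) / total_weight (sel u))
  (fun i u => phi i (sel u)) (fun i => measurableT_comp (mp i) msel)
  (fun i => measurableT_comp (mphi i) msel) (fun i u => p0 i (sel u)) (fun u => p1 (sel u)).
have X2E' : X2 = sel \o X1 by apply/funext.
exists k1, k2; split.
- apply: (@is_cond_law_smooth _ _ _ _ _ _ psi _ _ (fun x => (x, x)) phi) => //.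
  by move=> x B; rewrite k1E selE.
- apply: (@is_cond_law_smooth _ _ _ _ _ _ psi _ _ id phi) => //.
    by rewrite X2E'; exact: measurableT_comp.
  by move=> i x; rewrite X2E X1psi selE.
- by apply: aeW => z B mB; rewrite k1E k2E X2E.
Qed.

Definition project (z : E * E) : E * E := (z.1, tsub z.2 (drift z.1)).

Let mproject : measurable_fun setT project.
Proof.
apply: measurable_fun_pair => //; apply: measurable_tsub => //.
exact: measurableT_comp.
Qed.

Definition pair_project (z : E * E) : (E * E) * (E * E) := (z, project z).

Let mpair_project : measurable_fun setT pair_project.
Proof. exact: measurable_fun_pair. Qed.

HB.instance Definition _ := isMeasurableFun.Build _ _ _ _ project mproject.
HB.instance Definition _ := isMeasurableFun.Build _ _ _ _ pair_project mpair_project.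

Definition projected_law : probability (E * E)%type R := distribution Pt project.
Definition projection_coupling : probability ((E * E) * (E * E))%type R :=
  distribution Pt pair_project.

Lemma bicausal_coupling_project : bicausal_coupling Pt projected_law projection_coupling.
Proof.
split.
- by move=> A mA; rewrite /projection_coupling/= /distribution /pushforward.
- by move=> A mA; rewrite /projection_coupling /projected_law/= /distribution /pushforward.
- apply: (@same_cond_law_smooth _ _ _ _ _ _ _ _ jump fst) => //.
  + by apply: measurable_fun_pair; apply: measurableT_comp.
  + exact: measurableT_comp.
- apply: (@same_cond_law_smooth _ _ _ _ _ _ _ _ (fun i x => tsub (jump i x) (drift x)) snd) => //.
  + by apply: measurable_fun_pair; apply: measurableT_comp.
  + exact: measurableT_comp.
  + by move=> i; exact: measurable_tsub.
Qed.

Let shifted_first_moment i (j : 'I_d) (K : R) : 0 <= K ->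
  (\int[lebd d]_x ((`|tnth x j| + K)%:E * (weight i x)%:E) < +oo)%E.
Proof.
move=> K0; pose F (x : E) : \bar R := ((`|tnth x j| + K)%:E * (weight i x)%:E)%E.
have mj : measurable_fun setT (fun x : E => `|tnth x j|).
  by apply: measurableT_comp => //; exact: measurable_tnth.
have mF : measurable_fun setT F.
  apply: emeasurable_funM; apply/measurable_EFinP => //.
  exact: measurable_funD.
have F0 x : (0 <= F x)%E by rewrite mule_ge0 ?lee_fin// addr_ge0.
have := @ge0_integral_affine R d (s i).1 1 F ltr01 mF F0.
rewrite expr1n invr1 mul1e => <-.
pose a := tnth (s i).1 j.
apply: (@le_lt_trans _ _ (\int[nu]_x (`|tnth x j|%:E + (`|a| + K)%:E))%E).
  rewrite (@ge0_integral_density _ _ _ (lebd d) nu f mf (fun x => ltW (f0 x)) nuE)//; last 2 first.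
  - by apply/measurable_EFinP; exact: measurable_funD.
  - by move=> x; rewrite -EFinD lee_fin !addr_ge0.
  apply: ge0_le_integral => //.
  - exact: measurableT_comp mF (measurable_affine _ _).
  - apply: emeasurable_funM; apply/measurable_EFinP => //.
    exact: measurable_funD.
  move=> x _; rewrite /F -!EFinM lee_fin.
  have -> : weight i (affine (s i).1 1 x) = f x.
    by congr f; apply: eq_from_tnth => k; rewrite !tnth_mktuple; lra.
  rewrite ler_pM2r// tnth_mktuple mul1r addrA lerD2r addrC.
  by rewrite (le_trans (ler_normD _ _))// addrC.
rewrite ge0_integralD//; last 2 first.
- exact/measurable_EFinP.
- by move=> x _; rewrite lee_fin addr_ge0.
rewrite integral_cst//= (_ : nu setT = 1%E) ?mule1; last exact: probability_setT.
by rewrite lte_add_pinfty// ltry.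
Qed.

Let projected_law_integrable (F : E * E -> R) (j : 'I_d) (K : R) :
  0 <= K -> measurable_fun setT F ->
  (forall i x, `|F (project (x, jump i x))| <= `|tnth x j| + K) ->
  projected_law.-integrable setT (EFin \o F).
Proof.
move=> K0 mF FK; apply/integrableP; split; first exact/measurable_EFinP.
have mF' : measurable_fun setT (fun z => `|(EFin \o F) z|%E).
  by apply: measurableT_comp => //; exact/measurable_EFinP.
rewrite /projected_law/= ge0_integral_distribution_smooth//.
have mj : measurable_fun setT (fun x : E => `|tnth x j|).
  by apply: measurableT_comp => //; exact: measurable_tnth.
have mG i : measurable_fun setT (fun x : E => ((`|tnth x j| + K)%:E * (weight i x)%:E)%E).
  by apply: emeasurable_funM; apply/measurable_EFinP => //; exact: measurable_funD.
apply: (@le_lt_trans _ _ ((n%:R^-1)%:E *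
    \int[lebd d]_x \sum_(i < n) ((`|tnth x j| + K)%:E * (weight i x)%:E))%E).
  rewrite lee_pmul2l// ?lte_fin ?invr_gt0 ?ltr0n//.
  apply: ge0_le_integral => //.
  - by move=> x _; apply: sume_ge0 => i _; rewrite mule_ge0// lee_fin.
  - apply: emeasurable_sum => i; apply: emeasurable_funM; last exact/measurable_EFinP.
    apply: measurableT_comp mF' _; apply: measurableT_comp mproject _.
    exact: measurable_fun_pair.
  - exact: emeasurable_sum.
  - by move=> x _; apply: lee_sum => i _; apply: lee_wpmul2r; rewrite ?lee_fin.
rewrite ge0_integral_sum//; last first.
  by move=> i x _; rewrite mule_ge0 ?lee_fin// addr_ge0.
rewrite lte_mul_pinfty// ?lee_fin ?invr_ge0//.
by apply: lte_sum_pinfty => i _; exact: shifted_first_moment.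
Qed.

Let drift_le (j : 'I_d) x : `|tnth (drift x) j| <= \sum_(i < n) `|tnth (increment i) j|.
Proof.
rewrite tnth_mktuple normrM normfV (gtr0_norm (S_gt0 x)) ler_pdivrMr//.
rewrite mulr_sumr (le_trans (ler_norm_sum _ _ _))//; apply: ler_sum => i _.
rewrite normrM (ger0_norm (w_ge0 i x)) ler_wpM2r//.
by rewrite (bigD1 i)//= lerDl sumr_ge0.
Qed.

Let drift_balance (j : 'I_d) x :
  \sum_(i < n) (tnth (increment i) j - tnth (drift x) j) * weight i x = 0.
Proof.
under eq_bigr do rewrite mulrBl.
by rewrite sumrB -mulr_sumr -/(total_weight x) tnth_mktuple divfK// subrr.
Qed.

(** At every point the increment minus the drift is centred under the weights. The
    integral formula is for nonnegative functions, so the positive and the negative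
    part are compared pointwise. *)
Lemma martingale_pair_project : martingale_pair projected_law fst snd.
Proof.
move=> j; pose K := \sum_(i < n) `|tnth (increment i) j|.
have K0 : 0 <= K by exact: sumr_ge0.
have m1 : measurable_fun setT (fun z : E * E => tnth z.1 j).
  exact: measurableT_comp (@measurable_tnth _ _ _ j) measurable_fst.
have m2 : measurable_fun setT (fun z : E * E => tnth z.2 j).
  exact: measurableT_comp (@measurable_tnth _ _ _ j) measurable_snd.
have i1 : projected_law.-integrable setT (EFin \o (fun z => tnth z.1 j)).
  by apply: (@projected_law_integrable _ j 0) => // i x; rewrite addr0.
have i2 : projected_law.-integrable setT (EFin \o (fun z => tnth z.2 j)).
  apply: (@projected_law_integrable _ j (K + K)); rewrite ?addr_ge0// => i x.
  rewrite /project/= tnth_mktuple tnth_mktuple (le_trans (ler_normB _ _))//.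
  rewrite addrA lerD ?drift_le// (le_trans (ler_normD _ _))// lerD2l.
  by rewrite /K (bigD1 i)//= lerDl sumr_ge0.
split => //.
  move=> _ [A mA <-]; rewrite setTI; exists (@tnth _ R ^~ j @^-1` A) => //.
    by rewrite -[X in measurable X]setTI; exact: measurable_tnth.
  by rewrite setTI.
move=> _ [A mA <-]; rewrite setTI.
have mfA : measurable (@fst E E @^-1` A).
  by rewrite -[X in measurable X]setTI; exact: measurable_fst.
pose D (z : E * E) := tnth z.2 j - tnth z.1 j.
have mD : measurable_fun setT D by exact: measurable_funB.
have iD : projected_law.-integrable (fst @^-1` A) (EFin \o D).
  apply: (integrableS measurableT) => //.
  exact: (integrableB measurableT i2 i1).
transitivity (\int[projected_law]_(z in fst @^-1` A)
    ((EFin \o (fun z => tnth z.1 j)) z + (EFin \o D) z))%E.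
  by apply: eq_integral => z _; rewrite /= -EFinD /D; congr EFin; lra.
rewrite integralD//; last exact: integrableS i1.
rewrite [X in (_ + X)%E](_ : _ = 0%E) ?adde0// integralE.
have -> : (\int[projected_law]_(x in fst @^-1` A) ((EFin \o D)^\+ x) =
           \int[projected_law]_(x in fst @^-1` A) ((EFin \o D)^\- x))%E.
  rewrite !(integral_mkcond (fst @^-1` A)) /projected_law/=.
  have mDe : measurable_fun setT (EFin \o D) by exact/measurable_EFinP.
  rewrite !ge0_integral_distribution_smooth//; last 4 first.
  - apply/(measurable_restrictT _ _).1 => //; apply: measurable_funTS; exact: measurable_funeneg.
  - by move=> z; rewrite patchE; case: ifP.
  - apply/(measurable_restrictT _ _).1 => //; apply: measurable_funTS; exact: measurable_funepos.
  - by move=> z; rewrite patchE; case: ifP.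
  congr (_ * _)%E; apply: eq_integral => x _.
  have pA i : (project (x, jump i x) \in fst @^-1` A) = (x \in A).
    by apply/idP/idP; rewrite !inE.
  under eq_bigr do rewrite patchE pA.
  under [RHS]eq_bigr do rewrite patchE pA.
  case: (x \in A) => //.
  have DE i : D (project (x, jump i x)) = tnth (increment i) j - tnth (drift x) j.
    by rewrite /D /project/= !tnth_mktuple; lra.
  transitivity (\sum_(i < n) (Num.max (tnth (increment i) j - tnth (drift x) j) 0 * weight i x))%:E.
    by rewrite -sumEFin; apply: eq_bigr => i _; rewrite funeposE /= DE EFinM EFin_max.
  transitivity (\sum_(i < n)
      (Num.max (- (tnth (increment i) j - tnth (drift x) j)) 0 * weight i x))%:E; last first.
    by rewrite -sumEFin; apply: eq_bigr => i _; rewrite funenegE /= DE EFinM EFin_max.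
  congr EFin; apply/eqP; rewrite -subr_eq0 -sumrB -[X in _ == X](drift_balance j x).
  apply/eqP/eq_bigr => i _; rewrite -mulrBl; congr (_ * _).
  by rewrite /Num.max; case: ifP => ?; case: ifP => ?; lra.
rewrite subee//; apply: integrable_neg_fin_num => //.
Qed.

(** The coupling that subtracts the drift from the second coordinate costs the
    mean norm of the drift, and the density of the first coordinate cancels its
    denominator. *)
Lemma smoothed_MPD_le :
  (smoothed_MPD nu (empirical s n0) <=
   (n%:R^-1)%:E * \int[lebd d]_x (\sum_(j < d) `|\sum_(i < n)
     tnth (tsub (s i).2 (s i).1) j * f (tsub x (s i).1)|)%:E)%E.
Proof.
apply: (@le_trans _ _ (AW1 Pt projected_law)).
  by apply: ereal_inf_lbound; exists projected_law => //; exact: martingale_pair_project.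
apply: (@le_trans _ _ (\int[projection_coupling]_z
    (enorm (tsub z.1.2 z.2.2) + enorm (tsub z.1.1 z.2.1))%:E)%E).
  by apply: ereal_inf_lbound; exists projection_coupling => //; exact: bicausal_coupling_project.
have me (a b : (E * E) * (E * E) -> E) : measurable_fun setT a -> measurable_fun setT b ->
    measurable_fun setT (fun z => enorm (tsub (a z) (b z))).
  by move=> ma mb; apply: measurableT_comp (@measurable_enorm _ _) _; exact: measurable_tsub.
have mcost : measurable_fun setT (fun z : (E * E) * (E * E) =>
    (enorm (tsub z.1.2 z.2.2) + enorm (tsub z.1.1 z.2.1))%:E).
  by apply/measurable_EFinP/measurable_funD; apply: me; apply: measurableT_comp.
rewrite /projection_coupling/= ge0_integral_distribution_smooth//; last first.
  by move=> z; rewrite lee_fin addr_ge0 ?enorm_ge0.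
rewrite lee_pmul2l// ?lte_fin ?invr_gt0 ?ltr0n//; apply: ge0_le_integral => //.
- by move=> x _; apply: sume_ge0 => i _; rewrite mule_ge0 ?lee_fin ?addr_ge0 ?enorm_ge0.
- apply: emeasurable_sum => i; apply: emeasurable_funM; last exact/measurable_EFinP.
  apply: measurableT_comp mcost _; apply: measurableT_comp mpair_project _.
  exact: measurable_fun_pair.
- apply/measurable_EFinP; apply: measurable_sum => j; apply: measurableT_comp => //.
  by apply: measurable_sum => i; apply: measurable_funM => //; exact: mw.
move=> x _.
rewrite [X in (_ <= X%:E)%E](_ : _ = \sum_(j < d) `|tnth (drift x) j| * total_weight x); last first.
  by apply: eq_bigr => j _; rewrite tnth_mktuple normrM normfV (gtr0_norm (S_gt0 x)) divfK.
rewrite -mulr_suml /total_weight mulr_sumr -sumEFin; apply: lee_sum => i _.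
rewrite -EFinM lee_fin ler_wpM2r//= /pair_project /project/=.
have -> : tsub (jump i x) (tsub (jump i x) (drift x)) = drift x.
  by apply: eq_from_tnth => j; rewrite !tnth_mktuple; lra.
have -> : enorm (tsub x x) = 0.
  rewrite /enorm big1 ?sqrtr0// => j _; rewrite tnth_mktuple subrr expr0n//.
by rewrite addr0; exact: enorm_le_sum.
Qed.

End projection.

(** * Sums of centred i.i.d. variables *)

Section iid.
Local Open Scope ereal_scope.
Context dV (V : measurableType dV) dS (Sm : measurableType dS) (R : realType).
Variables (PS : probability Sm R) (mu : probability V R) (n : nat)
  (xi : 'I_n -> {mfun Sm >-> V}).
Hypotheses (xi_law : forall i A, measurable A -> PS (xi i @^-1` A) = mu A)
  (xi_indep : independent_family PS (fun i => xi i : Sm -> V)).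

Let mxi i : measurable_fun setT (xi i). Proof. by []. Qed.

Lemma ge0_integral_law i (F : V -> \bar R) : measurable_fun setT F ->
  (forall v, 0 <= F v) -> \int[PS]_w F (xi i w) = \int[mu]_v F v.
Proof.
move=> mF F0.
transitivity (\int[pushforward PS (xi i)]_v F v).
  by rewrite (ge0_integral_pushforward (mxi i))// preimage_setT.
by apply: eq_measure_integral => A mA _; exact: xi_law.
Qed.

Variable (h : V -> R).
Hypotheses (mh : measurable_fun setT h)
  (h2 : \int[mu]_v (h v ^+ 2)%:E < +oo) (Eh : \int[mu]_v (h v)%:E = 0).

Let mh2 : measurable_fun setT (fun v => (h v ^+ 2)%:E).
Proof. by apply/measurable_EFinP; exact: measurable_funX. Qed.

Let mhxi i : measurable_fun setT (fun w => h (xi i w)).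
Proof. exact: measurableT_comp mh (mxi i). Qed.

Let integrable_sqr (dT : measure_display) (T : measurableType dT) (Q : probability T R)
    (a b : T -> R) :
  measurable_fun setT a -> measurable_fun setT b ->
  \int[Q]_v (a v ^+ 2)%:E < +oo -> \int[Q]_v (b v ^+ 2)%:E < +oo ->
  Q.-integrable setT (EFin \o (fun v => a v * b v)%R).
Proof.
move=> ma mb a2 b2; apply/integrableP; split.
  by apply/measurable_EFinP; exact: measurable_funM.
apply: (@le_lt_trans _ _ (\int[Q]_v ((a v ^+ 2)%:E + (b v ^+ 2)%:E))).
  apply: ge0_le_integral => //.
  - apply: measurableT_comp => //; apply/measurable_EFinP; exact: measurable_funM.
  - by apply: emeasurable_funD; apply/measurable_EFinP; exact: measurable_funX.
  move=> v _ /=; rewrite -EFinD lee_fin normrM -(real_normK (num_real (a v))).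
  rewrite -(real_normK (num_real (b v))).
  have := normr_ge0 (a v); have := normr_ge0 (b v).
  move: `|a v|%R `|b v|%R => x y; nra.
rewrite ge0_integralD//.
- exact: lte_add_pinfty.
- by move=> v _; rewrite lee_fin sqr_ge0.
- by apply/measurable_EFinP; exact: measurable_funX.
- by move=> v _; rewrite lee_fin sqr_ge0.
- by apply/measurable_EFinP; exact: measurable_funX.
Qed.

Let h_integrable : mu.-integrable setT (EFin \o h).
Proof.
rewrite (_ : h = fun v => h v * 1)%R; last by apply/funext => v; rewrite mulr1.
apply: integrable_sqr => //; under eq_integral do rewrite expr1n.
by rewrite integral_cst//= (_ : mu setT = 1) ?mule1 ?ltry//; exact: probability_setT.
Qed.

Let xi_sqr i : \int[PS]_w (h (xi i w) ^+ 2)%:E = \int[mu]_v (h v ^+ 2)%:E.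
Proof.
by rewrite (@ge0_integral_law i (fun v => (h v ^+ 2)%:E))// => v; rewrite lee_fin sqr_ge0.
Qed.

Let xi_integrable i k : PS.-integrable setT (EFin \o (fun w => h (xi i w) * h (xi k w))%R).
Proof. by apply: integrable_sqr => //; rewrite xi_sqr. Qed.

(** Independence of the pair, read off the product rule for the subfamily
    [{i, k}]. *)
Lemma pair_law i k : i != k -> forall A, measurable A ->
  (mu \x mu) A = PS ((fun w => (xi i w, xi k w)) @^-1` A).
Proof.
move=> ik; have mp : measurable_fun setT (fun w => (xi i w, xi k w)).
  exact: measurable_fun_pair.
pose m : {measure set (V * V) -> \bar R} := pushforward PS (fun w => (xi i w, xi k w)).
move=> A mA; apply: (product_measure_unique (m' := m mp)) => // {A mA} A B mA mB.
rewrite /m/= /pushforward -(xi_law i mA) -(xi_law k mB).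
pose C (l : 'I_n) := if l == i then A else B.
have mC l : measurable (C l) by rewrite /C; case: ifP.
have := xi_indep [set i; k]%SET mC.
rewrite big_setU1/= ?big_set1 ?inE//.
have -> : C i = A by rewrite /C eqxx.
have -> : C k = B by rewrite /C eq_sym (negbTE ik).
move=> <-; congr (PS _).
apply/seteqP; split => w /=.
  move=> [wA wB] l /=; rewrite !inE /C; case: ifPn => [/eqP -> //|_ /= /eqP -> //].
move=> H; split.
  by have := H i; rewrite /= !inE eqxx /C eqxx; exact.
by have := H k; rewrite /= !inE eqxx orbT /C eq_sym (negbTE ik); exact.
Qed.

Let xi_uncorrelated i k : i != k -> \int[PS]_w (h (xi i w) * h (xi k w))%:E = 0.
Proof.
move=> ik; have mp : measurable_fun setT (fun w => (xi i w, xi k w)).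
  exact: measurable_fun_pair.
pose H (z : V * V) := (h z.1 * h z.2)%:E.
have mH : measurable_fun setT H.
  by apply/measurable_EFinP; apply: measurable_funM; exact: measurableT_comp.
transitivity (\int[pushforward PS (fun w => (xi i w, xi k w))]_z H z).
  by rewrite (integral_pushforward mp mH)//= preimage_setT//; exact: xi_integrable.
transitivity (\int[mu \x mu]_z H z).
  by apply: eq_measure_integral => A mA _; exact/esym/(pair_law ik mA).
rewrite -integral12_prod_meas1.
  rewrite /fubini_F integral0_eq// => v _.
  rewrite /H/=; under eq_integral do rewrite EFinM.
  by rewrite integralZl//= Eh mule0.
apply/integrableP; split => //.
have /integrableP[_] := integrable_pushforward mp mH (xi_integrable i k) measurableT.
by rewrite (eq_measure_integral (mu \x mu)%E)// => A mA _; exact/esym/(pair_law ik mA).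
Qed.

Lemma iid_sum_sqr : \int[PS]_w ((\sum_(i < n) h (xi i w)) ^+ 2)%:E =
  n%:R%:E * \int[mu]_v (h v ^+ 2)%:E.
Proof.
transitivity (\int[PS]_w \sum_(i < n) \sum_(k < n) (h (xi i w) * h (xi k w))%:E).
  apply: eq_integral => w _; rewrite expr2 mulr_suml -sumEFin; apply: eq_bigr => i _.
  by rewrite mulr_sumr sumEFin.
rewrite integral_sum//; last by move=> i; apply: integrable_sum => // k _; exact: xi_integrable.
transitivity (\sum_(i < n) \int[mu]_v (h v ^+ 2)%:E); last first.
  by rewrite sumr_const card_ord mule_natl.
apply: eq_bigr => i _; rewrite integral_sum//; last by move=> k; exact: xi_integrable.
rewrite (bigD1 i)//= big1 ?adde0; last by move=> k ki; rewrite xi_uncorrelated// eq_sym.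
by rewrite -(xi_sqr i); apply: eq_integral => w _; rewrite expr2.
Qed.

(** |W| <= W^2 / (2 b) + b / 2 for every b > 0; the choice b = B + e also covers
    [B = 0]. *)
Lemma iid_sum_L1 (B : R) : (0 <= B)%R ->
  n%:R%:E * \int[mu]_v (h v ^+ 2)%:E <= (B ^+ 2)%:E ->
  \int[PS]_w `|\sum_(i < n) h (xi i w)|%:E <= B%:E.
Proof.
move=> B0; rewrite -iid_sum_sqr; set W := fun w => (\sum_(i < n) h (xi i w))%R.
move=> HB; apply/lee_addgt0Pr => e e0.
have mW : measurable_fun setT W by exact: measurable_sum.
have Be : (0 < B + e)%R by rewrite ltr_wpDl.
apply: (@le_trans _ _ (\int[PS]_w ((2 * (B + e))^-1%:E * (W w ^+ 2)%:E + ((B + e) / 2)%:E))).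
  apply: ge0_le_integral => //.
  - by apply/measurable_EFinP; exact: measurableT_comp.
  - apply: emeasurable_funD => //; apply: emeasurable_funM => //.
    by apply/measurable_EFinP; exact: measurable_funX.
  move=> w _; rewrite -EFinM -EFinD lee_fin -(real_normK (num_real (W w))).
  rewrite -/(W w); move: `|W w|%R => x.
  rewrite -subr_ge0 [X in (_ <= X)%R](_ : _ = (x - (B + e)) ^+ 2 / (2 * (B + e)))%R.
    by rewrite divr_ge0 ?sqr_ge0// mulr_ge0// ltW.
  by field; rewrite gt_eqF.
rewrite ge0_integralD//; last 3 first.
- by move=> w _; rewrite -EFinM lee_fin mulr_ge0 ?sqr_ge0// invr_ge0 mulr_ge0// ltW.
- apply: emeasurable_funM => //; by apply/measurable_EFinP; exact: measurable_funX.
- by move=> w _; rewrite lee_fin divr_ge0// ltW.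
rewrite ge0_integralZl_EFin//; last 3 first.
- by move=> w _; rewrite lee_fin sqr_ge0.
- by apply/measurable_EFinP; exact: measurable_funX.
- by rewrite invr_ge0 mulr_ge0// ltW.
rewrite integral_cst//= (_ : PS setT = 1) ?mule1; last exact: probability_setT.
apply: (@le_trans _ _ ((2 * (B + e))^-1%:E * (B ^+ 2)%:E + ((B + e) / 2)%:E)).
  by rewrite leeD2r// lee_wpmul2l// lee_fin invr_ge0 mulr_ge0// ltW.
rewrite -EFinM -!EFinD lee_fin mulrC -lerBrDr ler_pdivrMr ?mulr_gt0//.
have -> : ((B + e - (B + e) / 2) * (2 * (B + e)) = (B + e) ^+ 2)%R by field.
by rewrite ler_pXn2r// ?nnegrE ?lerDl// ltW.
Qed.

End iid.

(** * Second moments on events and tail probabilities *)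

Section moments.
Context dO (Om : measurableType dO) (R : realType) (P : probability Om R).
Variables (p q : R).
Hypotheses (p1 : 1 < p) (pq : p^-1 + q^-1 = 1).

Let p0 : 0 < p. Proof. exact: lt_trans p1. Qed.

Lemma conjugate_gt0 : 0 < q.
Proof.
have : 0 < q^-1 by rewrite -(addKr p^-1 q^-1) pq addrC subr_gt0 invf_lt1.
by rewrite invr_gt0.
Qed.

Let q0 := conjugate_gt0.

Lemma conjugate_div : p / q = p - 1.
Proof.
have -> : q^-1 = 1 - p^-1 by rewrite -pq addrC addKr.
by rewrite mulrBr mulr1 divff// gt_eqF.
Qed.

(** Hoelder with exponents [p] and [q] for the square of [D] and the indicator. *)
Lemma second_moment_on_event_le (D : Om -> R) (N : R) (A : set Om) :
  measurable_fun setT D -> measurable A -> 0 <= N ->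
  Lnorm P (2 * p)%:E (EFin \o D) = N%:E ->
  (\int[P]_w (D w ^+ 2 * \1_A w)%:E <= (N ^+ 2)%:E * (P A) `^ q^-1)%E.
Proof.
move=> mD mA N0 DN.
have mA' : measurable_fun setT (\1_A : Om -> R) by exact: measurable_indic.
have mD2 : measurable_fun setT (fun w => D w ^+ 2) by exact: measurable_funX.
have := hoelder P mD2 mA' p0 q0 pq.
rewrite Lnorm1 => H.
apply: (le_trans (le_trans _ H)).
  rewrite le_eqVlt; apply/orP; left; apply/eqP; apply: eq_integral => w _ /=.
  by rewrite ger0_norm// mulr_ge0 ?sqr_ge0.
rewrite le_eqVlt; apply/orP; left; apply/eqP; congr (_ * _)%E.
  have p20 : 2 * p != 0 by rewrite mulf_neq0// gt_eqF.
  have := powR_Lnorm P (EFin \o D) p20; rewrite DN poweR_EFin => I2p.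
  rewrite unlock (_ : \int[P]_x _ = (N `^ (2 * p))%:E)%E.
    rewrite poweR_EFin -powRrM -mulrA mulfV ?gt_eqF// mulr1 powR_mulrn//.
  rewrite I2p; apply: eq_integral => w _ /=; rewrite normrX.
    by rewrite -powR_mulrn// -powRrM.
rewrite unlock; congr (_ `^ _)%E.
rewrite -[in RHS](setIT A) -integral_indic//; apply: eq_integral => w _ /=.
rewrite indicE; case: (w \in A); rewrite ?normr1 ?powR1// normr0 powR0//.
by rewrite gt_eqF.
Qed.

(** Markov for the moment of order [2 * p]; since [p / q = p - 1], the power
    [q^-1] of the bound is a perfect square, as needed for an L2 norm. *)
Lemma tail_probability_le (V : Om -> R) (r m2 : R) : measurable_fun setT V ->
  (forall w, 0 <= V w) -> 0 < r -> (\int[P]_w (V w `^ (2 * p))%:E = m2%:E)%E ->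
  ((P [set w | (r < V w)%R]) `^ q^-1 <= ((m2 `^ (2 * q)^-1 * r `^ (- (p - 1))) ^+ 2)%:E)%E.
Proof.
move=> mV V0 r0 Vm.
set A := [set w | _].
have mA : measurable A.
  rewrite -[X in measurable X]setTI (_ : A = V @^-1` `]r, +oo[); first exact: mV.
  by apply/seteqP; split => w /=; rewrite /A/= in_itv/= andbT.
have m20 : 0 <= m2.
  by rewrite -lee_fin -Vm; apply: integral_ge0 => w _; rewrite lee_fin powR_ge0.
have mV2 : measurable_fun setT (fun w => (V w `^ (2 * p))%:E).
  by apply/measurable_EFinP; exact: measurableT_comp (measurable_powR _) mV.
have PA : (P A <= (r `^ (- (2 * p)) * m2)%:E)%E.
  rewrite EFinM -Vm -ge0_integralZl_EFin ?powR_ge0//; last first.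
    by move=> w _; rewrite lee_fin powR_ge0.
  rewrite -[X in P X](setIT A) -integral_indic//; apply: ge0_le_integral => //.
  - by apply/measurable_EFinP; exact: measurable_indic.
  - by apply: emeasurable_funM.
  move=> w _; rewrite -EFinM lee_fin indicE.
  case: (boolP (w \in A)) => [|_]; last by rewrite mulr_ge0 ?powR_ge0.
  rewrite inE /A/= => rV; rewrite powRN ler_pdivlMl ?powR_gt0// mulr1.
  apply: ge0_ler_powR; rewrite ?nnegrE ?mulr_ge0 ?(ltW p0)//; exact: ltW.
apply: (@le_trans _ _ ((r `^ (- (2 * p)) * m2)%:E `^ q^-1)%E).
  apply: gt0_ler_poweR => //; rewrite ?invr_ge0 ?(ltW q0)//.
  - by rewrite in_itv/= measure_ge0 leey.
  - by rewrite in_itv/= lee_fin mulr_ge0 ?powR_ge0// leey.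
rewrite poweR_EFin lee_fin le_eqVlt; apply/orP; left; apply/eqP.
rewrite powRM ?powR_ge0// exprMn mulrC; congr (_ * _).
  by rewrite -[RHS]powR_mulrn ?powR_ge0// -powRrM; congr (_ `^ _); field; rewrite gt_eqF.
rewrite -[LHS]powRrM -[RHS](powR_mulrn 2 (powR_ge0 _ _)) -[RHS]powRrM -conjugate_div.
congr (_ `^ _).
by field; rewrite gt_eqF.
Qed.

End moments.

(** * The smoothing density *)

Section density.
Context {R : realType} (d : nat).
Local Notation E := (d.-tuple R).
Variables (rho sigma : R) (nu : probability E R).
Hypotheses (d0 : (0 < d)%N) (sigma0 : 0 < sigma) (drho : d%:R + 1 < rho)
  (nuE : has_density nu (xi_density rho sigma)).

Let f : E -> R := xi_density rho sigma.
Let kappa : R := sigma ^- d * C_ d rho.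

Let rho0 : 0 < rho.
Proof. by apply: le_lt_trans drho; rewrite addr_ge0. Qed.

Let base_ge1 (x : E) : 1 <= enorm x / sigma + 1.
Proof. by rewrite lerDr divr_ge0 ?enorm_ge0// ltW. Qed.

Let base_gt0 (x : E) : 0 < enorm x / sigma + 1.
Proof. exact: lt_le_trans (base_ge1 x). Qed.

Lemma measurable_xi_density : measurable_fun setT f.
Proof.
apply: measurable_funM => //; apply: measurableT_comp (measurable_powR _) _.
apply: measurable_funD => //; apply: measurable_funM => //; exact: measurable_enorm.
Qed.

Lemma C_ge0 : 0 <= C_ d rho.
Proof.
rewrite invr_ge0 fine_ge0//; apply: integral_ge0 => x _.
by rewrite lee_fin powR_ge0.
Qed.

(** A vanishing constant would make the density, hence the total mass, vanish. *)
Lemma C_gt0 : 0 < C_ d rho.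
Proof.
rewrite lt_def C_ge0 andbT; apply/eqP => C0.
have := nuE measurableT; rewrite (_ : nu setT = 1%E); last exact: probability_setT.
rewrite integral0_eq; first by move/eqP; rewrite onee_eq0.
by move=> x _; rewrite /xi_density C0 mulr0 mul0r.
Qed.

Let kappa_gt0 : 0 < kappa.
Proof. by rewrite mulr_gt0 ?C_gt0// invr_gt0 exprn_gt0. Qed.

Lemma xi_density_gt0 x : 0 < f x.
Proof. by rewrite mulr_gt0// powR_gt0. Qed.

Lemma xi_density_le x : f x <= kappa.
Proof.
rewrite /f /xi_density -/kappa ler_piMr ?(ltW kappa_gt0)//.
by rewrite powRN invf_le1 ?powR_gt0// -[X in X <= _](powRr0 (enorm x / sigma + 1)) ler_powR// ltW.
Qed.

Lemma xi_density_tail_le (r : R) x : 0 < r -> r <= enorm x ->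
  f x <= kappa * (sigma `^ rho * r `^ (- rho)).
Proof.
move=> r0 rx; rewrite /f /xi_density -/kappa ler_pM2l//.
rewrite !powRN ler_pdivlMr ?powR_gt0// ler_pdivrMl ?powR_gt0//.
rewrite -powRM ?(ltW sigma0) ?(ltW (base_gt0 x))//.
apply: ge0_ler_powR;
  rewrite ?nnegrE ?mulr_ge0 ?(ltW r0) ?(ltW sigma0) ?(ltW rho0) ?(ltW (base_gt0 x))//.
by rewrite mulrDl divfK ?gt_eqF// (le_trans rx)// lerDl mulr_ge0 ?ltW.
Qed.

(** By contradiction from |x|^2 <= 2 |x - y|^2 + 2 |y|^2, which holds coordinatewise. *)
Lemma enorm_tsub_ge (x y : E) : enorm y <= enorm x / 2 -> enorm x / 2 <= enorm (tsub x y).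
Proof.
move=> yx; rewrite leNgt; apply/negP => uy.
have H : enorm x ^+ 2 <= 2 * enorm (tsub x y) ^+ 2 + 2 * enorm y ^+ 2.
  rewrite !sqr_enorm !mulr_sumr -big_split/=; apply: ler_sum => i _.
  rewrite tnth_mktuple; move: (tnth x i) (tnth y i) => a b.
  rewrite -subr_ge0 (_ : _ - _ = (a - 2 * b) ^+ 2) ?sqr_ge0//; ring.
have := enorm_ge0 x; have := enorm_ge0 y; have := enorm_ge0 (tsub x y).
by move: H yx uy; nra.
Qed.

(** The density decays like [enorm x `^ (- rho)], and [rho - 1 > d]. *)
Lemma xi_first_moment (j : 'I_d) : (\int[nu]_x `|tnth x j|%:E < +oo)%E.
Proof.
have mj : measurable_fun setT (fun x : E => `|tnth x j|).
  by apply: measurableT_comp => //; exact: measurable_tnth.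
have mf := measurable_xi_density.
have mjf : measurable_fun setT (fun x : E => (`|tnth x j| * f x)%:E).
  by apply/measurable_EFinP; exact: measurable_funM.
rewrite (@ge0_integral_density _ _ _ (lebd d) nu f mf
  (fun x => ltW (xi_density_gt0 x)) nuE)//; last first.
  exact/measurable_EFinP.
under eq_integral do rewrite -EFinM.
rewrite -(setvU (eball sigma)) ge0_integral_setU//; last 5 first.
- by apply: measurableC; exact: measurable_eball.
- exact: measurable_eball.
- by rewrite setvU.
- by move=> x _; rewrite lee_fin mulr_ge0// ltW// xi_density_gt0.
- by rewrite disj_set2E setICl.
rewrite lte_add_pinfty//.
  have ra : d%:R < rho - 1 by rewrite ltrBrDr.
  apply: (@le_lt_trans _ _ ((kappa * sigma `^ rho) %:E *
      \int[lebd d]_(x in ~` eball sigma) (enorm x `^ (- (rho - 1)))%:E)%E).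
    have mB : measurable (~` eball sigma : set E).
      by apply: measurableC; exact: measurable_eball.
    rewrite -ge0_integralZl_EFin//; last 3 first.
    - by move=> x _; rewrite lee_fin powR_ge0.
    - apply: measurable_funTS; apply/measurable_EFinP; exact: measurable_powR_enorm.
    - by rewrite mulr_ge0 ?powR_ge0// ltW.
    apply: ge0_le_integral => //.
    - by move=> x _; rewrite lee_fin mulr_ge0// ltW// xi_density_gt0.
    - exact: measurable_funTS.
    - apply: measurable_funTS; apply: emeasurable_funM => //.
      by apply/measurable_EFinP; exact: measurable_powR_enorm.
    move=> x /negP; rewrite -ltNge => xs; rewrite -EFinM lee_fin.
    have x0 : 0 < enorm x := lt_trans sigma0 xs.
    apply: (@le_trans _ _ (enorm x * (kappa * (sigma `^ rho * enorm x `^ (- rho))))).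
      apply: ler_pM; rewrite ?(ltW (xi_density_gt0 x)) ?abs_tnth_le_enorm//.
      exact: xi_density_tail_le.
    have -> : enorm x `^ (- (rho - 1)) = enorm x * enorm x `^ (- rho).
      by rewrite opprB powRD ?(gt_eqF x0) ?implybT// powRr1 ?enorm_ge0.
    by rewrite le_eqVlt; apply/orP; left; apply/eqP; ring.
  have K0 : 0 <= kappa * sigma `^ rho by rewrite mulr_ge0 ?powR_ge0// ltW.
  rewrite lte_mul_pinfty//.
  by rewrite (le_lt_trans (tail_integral_le d0 ra sigma0))// ltry.
apply: (@le_lt_trans _ _ (\int[lebd d]_(x in eball sigma) (sigma * kappa)%:E)%E).
  apply: ge0_le_integral => //.
  - exact: measurable_eball.
  - by move=> x _; rewrite lee_fin mulr_ge0// ltW// xi_density_gt0.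
  - exact: measurable_funTS.
  move=> x xs; rewrite lee_fin; apply: ler_pM; rewrite ?(ltW (xi_density_gt0 x)) ?xi_density_le//.
  exact: le_trans (abs_tnth_le_enorm _ _) xs.
rewrite integral_cst//; last exact: measurable_eball.
by rewrite /= lebd_ball// -EFinM ltry.
Qed.

End density.

(** * Conditional expectation and functions of the conditioning variable *)

Section density_measure.
Context dT (T : measurableType dT) (R : realType) (mu : {measure set T -> \bar R}).
Variables (u : T -> R) (mu_ : measurable_fun setT u) (u0 : forall x, 0 <= u x).
Local Open Scope ereal_scope.

(** The proofs are arguments so that the measure structure can be attached. *)
Definition density_measure (_ : measurable_fun setT u) (_ : forall x, (0 <= u x)%R)
  (A : set T) : \bar R := \int[mu]_(x in A) (u x)%:E.

Let m := density_measure mu_ u0.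

Let m0 : m set0 = 0. Proof. exact: integral_set0. Qed.

Let m_ge0 A : 0 <= m A.
Proof. by apply: integral_ge0 => x _; rewrite lee_fin. Qed.

Let m_sigma_additive : semi_sigma_additive m.
Proof.
move=> F mF tF mUF; rewrite /m /density_measure ge0_integral_bigcup//.
- by apply: is_cvg_nneseries => n _ _; exact: m_ge0.
- exact/measurable_funTS/measurable_EFinP.
- by move=> x _; rewrite lee_fin.
Qed.

HB.instance Definition _ := isMeasure.Build _ _ _ m m0 m_ge0 m_sigma_additive.

Lemma ge0_integral_density_measure (F : T -> \bar R) : measurable_fun setT F ->
  (forall x, 0 <= F x) -> \int[m]_x F x = \int[mu]_x (F x * (u x)%:E).
Proof. exact: (@ge0_integral_density _ _ _ mu m). Qed.

End density_measure.

Section cond_exp.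
Context dO (Om : measurableType dO) (R : realType) (P : probability Om R).
Context dU (U : measurableType dU) (X : Om -> U) (mX : measurable_fun setT X).
Local Open Scope ereal_scope.

(** By hypothesis the measures with densities [u] and [v] have the same image
    under [X]. *)
Lemma ge0_cond_exp_pull_out (u v : Om -> R) (phi : U -> R) :
  measurable_fun setT u -> measurable_fun setT v ->
  (forall w, 0 <= u w)%R -> (forall w, 0 <= v w)%R ->
  (forall A, measurable A ->
    \int[P]_(w in X @^-1` A) (u w)%:E = \int[P]_(w in X @^-1` A) (v w)%:E) ->
  measurable_fun setT phi -> (forall x, 0 <= phi x)%R ->
  \int[P]_w (phi (X w) * u w)%:E = \int[P]_w (phi (X w) * v w)%:E.
Proof.
move=> mu mv u0 v0 uv mphi phi0.
have mphiX : measurable_fun setT (fun w => (phi (X w))%:E).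
  by apply/measurable_EFinP; exact: measurableT_comp mphi mX.
have mphiE : measurable_fun setT (fun x => (phi x)%:E) by exact/measurable_EFinP.
have phi0E : {in [set: U], forall x, 0 <= (phi x)%:E} by move=> x _; rewrite lee_fin.
transitivity (\int[pushforward (density_measure P mu u0) X]_x (phi x)%:E).
  rewrite (ge0_integral_pushforward mX)//.
  rewrite preimage_setT (@ge0_integral_density_measure _ _ _ P u mu u0 (fun w => (phi (X w))%:E))//.
by move=> w; rewrite lee_fin.
transitivity (\int[pushforward (density_measure P mv v0) X]_x (phi x)%:E).
  by apply: eq_measure_integral => A mA _; exact: uv.
rewrite (ge0_integral_pushforward mX)//.
rewrite preimage_setT (@ge0_integral_density_measure _ _ _ P v mv v0 (fun w => (phi (X w))%:E))//.
by move=> w; rewrite lee_fin.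
Qed.

(** [Y - Z] is split as [u - v] with [u], [v] nonnegative and integrable; then
    [ge0_cond_exp_pull_out] applies to them. *)
Lemma cond_exp_orthogonal (Y Z : Om -> R) (phi : U -> R) (K : R) :
  is_cond_exp P X Y Z -> measurable_fun setT phi ->
  (forall x, 0 <= phi x <= K)%R ->
  \int[P]_w ((Y w - Z w) * phi (X w))%:E = 0.
Proof.
move=> [iY iZ _ YZ] mphi phiK.
have mY : measurable_fun setT Y by apply/measurable_EFinP; exact: measurable_int iY.
have mZ : measurable_fun setT Z by apply/measurable_EFinP; exact: measurable_int iZ.
pose u w := (Num.max (Y w) 0 + Num.max (- Z w) 0)%R.
pose v w := (Num.max (Z w) 0 + Num.max (- Y w) 0)%R.
have uvE w : (u w - v w = Y w - Z w)%R.
  by rewrite /u /v /Num.max; do 4 case: ifP => ?; lra.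
have uY w : (u w <= `|Y w| + `|Z w|)%R.
  rewrite /u lerD// ge_max ?normr_ge0 ?ler_norm//.
  by rewrite -[X in (_ <= X)%R]normrN ler_norm.
have vY w : (v w <= `|Y w| + `|Z w|)%R.
  rewrite /v addrC lerD// ge_max ?normr_ge0 ?ler_norm// andbT.
  by rewrite -[X in (_ <= X)%R]normrN ler_norm.
have u0 w : (0 <= u w)%R by rewrite addr_ge0// le_max lexx orbT.
have v0 w : (0 <= v w)%R by rewrite addr_ge0// le_max lexx orbT.
have mu : measurable_fun setT u.
  apply: measurable_funD; apply: measurable_maxr => //; exact: measurable_funN.
have mv : measurable_fun setT v.
  apply: measurable_funD; apply: measurable_maxr => //; exact: measurable_funN.
have dom (g : Om -> R) (c : R) : measurable_fun setT g -> (0 <= c)%R ->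
    (forall w, `|g w| <= c * (`|Y w| + `|Z w|))%R -> P.-integrable setT (EFin \o g).
  move=> mg c0 gc.
  have iD : P.-integrable setT (fun w => c%:E * (`|(EFin \o Y) w| + `|(EFin \o Z) w|)).
    apply: integrableZl => //; apply: integrableD => //; exact: integrable_abse.
  apply: (le_integrable measurableT _ _ iD); first exact/measurable_EFinP.
  move=> w _ /=; rewrite lee_fin (le_trans (gc w))// ler_norm//.
have iu : P.-integrable setT (EFin \o u).
  by apply: (dom u 1%R) => // w; rewrite mul1r ger0_norm.
have iv : P.-integrable setT (EFin \o v).
  by apply: (dom v 1%R) => // w; rewrite mul1r ger0_norm.
have uv A : measurable A ->
    \int[P]_(w in X @^-1` A) (u w)%:E = \int[P]_(w in X @^-1` A) (v w)%:E.
  move=> mA; have mXA : measurable (X @^-1` A).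
    by rewrite -[X in measurable X]setTI; exact: mX.
  have S (g : Om -> R) : P.-integrable setT (EFin \o g) -> P.-integrable (X @^-1` A) (EFin \o g).
    exact: integrableS.
  transitivity (\int[P]_(w in X @^-1` A)
     ((EFin \o v) w + ((EFin \o Y) w - (EFin \o Z) w))).
    by apply: eq_integral => w _; rewrite /= -EFinB -EFinD; congr EFin; rewrite -uvE; ring.
  rewrite integralD//; [|exact: S|by apply: integrableB => //; exact: S].
  rewrite integralB//; [|exact: S|exact: S].
  rewrite (YZ (X @^-1` A)) ?subee ?adde0//.
    by apply: integrable_fin_num => //; exact: S.
  by exists A => //; rewrite setTI.
have K0 : (0 <= K)%R by have /andP[] := phiK (X point); exact: le_trans.
have mphiX : measurable_fun setT (fun w => phi (X w)) by exact: measurableT_comp mphi mX.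
have iuphi (g : Om -> R) : measurable_fun setT g -> (forall w, 0 <= g w)%R ->
    (forall w, g w <= `|Y w| + `|Z w|)%R ->
    P.-integrable setT (EFin \o (fun w => phi (X w) * g w)%R).
  move=> mg g0 gY; apply: (dom _ K) => //; first exact: measurable_funM.
  move=> w; have /andP[p0 pK] := phiK (X w).
  by rewrite ger0_norm ?mulr_ge0//; apply: ler_pM.
transitivity (\int[P]_w ((EFin \o (fun w => phi (X w) * u w)%R) w -
                         (EFin \o (fun w => phi (X w) * v w)%R) w)).
  by apply: eq_integral => w _; rewrite /= -EFinB -uvE; congr EFin; ring.
rewrite integralB//; [|exact: iuphi|exact: iuphi].
rewrite (ge0_cond_exp_pull_out mu mv)//; last by move=> x; have /andP[] := phiK x.
rewrite subee//; apply: integrable_fin_num => //; exact: iuphi.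
Qed.

End cond_exp.

(** * The envelope of the weighted increments *)

Section rate.
Context {R : realType} (d : nat).
Local Notation E := (d.-tuple R).
Variables (rho sigma p q : R) (nu : probability E R).
Hypotheses (d0 : (0 < d)%N) (sigma0 : 0 < sigma) (drho : d%:R + 1 < rho)
  (dp : d%:R + 1 < p) (pq : p^-1 + q^-1 = 1)
  (nuE : has_density nu (xi_density rho sigma)).

Let f : E -> R := xi_density rho sigma.
Let kappa : R := sigma ^- d * C_ d rho.

Let p1 : 1 < p. Proof. by apply: le_lt_trans dp; rewrite lerDr. Qed.

(** Bounds the L2 norm of the weighted increment at [x], in units of
    [sigma ^- d * C_ d rho] times the norm of the increment: near the origin only
    the density is bounded; far away the first term is the chance that [X] is
    far from 0 and the second one the decay of the density. *)
Definition envelope (m : R) (x : E) : R :=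
  if enorm x <= sigma then 1
  else m * (enorm x / 2) `^ (- (p - 1)) + sigma `^ rho * (enorm x / 2) `^ (- rho).

Lemma envelope_ge0 m x : 0 <= m -> 0 <= envelope m x.
Proof.
by move=> m0; rewrite /envelope; case: ifP => // _; rewrite addr_ge0// mulr_ge0 ?powR_ge0.
Qed.

Lemma measurable_envelope m : measurable_fun setT (envelope m).
Proof.
have mh : measurable_fun setT (fun x : E => enorm x / 2).
  by apply: measurable_funM => //; exact: measurable_enorm.
apply: measurable_fun_ifT => //.
  by apply: measurable_fun_ler => //; exact: measurable_enorm.
by apply: measurable_funD; apply: measurable_funM => //;
  apply: measurableT_comp (measurable_powR _) mh.
Qed.

Section second_moment.
Context dO (Om : measurableType dO) (P : probability Om R).
Variables (X : Om -> E) (D : Om -> R) (N m2 : R).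
Hypotheses (mX : measurable_fun setT X) (mD : measurable_fun setT D) (N0 : 0 <= N)
  (DN : Lnorm P (2 * p)%:E (EFin \o D) = N%:E)
  (Xm : (\int[P]_w (enorm (X w) `^ (2 * p))%:E = m2%:E)%E).

(** Split according to whether [enorm (X w) <= enorm x / 2]; if so, [x - X w] has
    norm at least [enorm x / 2]. *)
Lemma weighted_second_moment_le x :
  (\int[P]_w ((D w * f (tsub x (X w))) ^+ 2)%:E <=
   ((kappa * N * envelope (m2 `^ (2 * q)^-1) x) ^+ 2)%:E)%E.
Proof.
set m := m2 `^ _.
have m0 : 0 <= m by exact: powR_ge0.
have k0 : 0 <= kappa by rewrite mulr_ge0 ?C_ge0// invr_ge0 exprn_ge0// ltW.
have f0 y : 0 <= f y by exact/ltW/(xi_density_gt0 sigma0 nuE).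
have fk y : f y <= kappa by exact: (xi_density_le sigma0 drho nuE).
have mfX : measurable_fun setT (fun w => f (tsub x (X w))).
  have mf : measurable_fun setT f by exact: measurable_xi_density.
  by apply: measurableT_comp mf _; exact: measurable_tsub.
have mDf : measurable_fun setT (fun w => ((D w * f (tsub x (X w))) ^+ 2)%:E).
  by apply/measurable_EFinP; apply: measurable_funX; exact: measurable_funM.
have mDA A : measurable A -> measurable_fun setT (fun w => (D w ^+ 2 * \1_A w)%:E).
  move=> mA; apply/measurable_EFinP; apply: measurable_funM; last exact: measurable_indic.
  exact: measurable_funX.
have DA0 A w : (0 <= (D w ^+ 2 * \1_A w)%:E)%E by rewrite lee_fin mulr_ge0// sqr_ge0.
have HT : (\int[P]_w (D w ^+ 2 * \1_setT w)%:E <= (N ^+ 2)%:E)%E.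
  have := second_moment_on_event_le p1 pq mD measurableT N0 DN.
  by rewrite (_ : P setT = 1%E) ?poweR1r ?mule1//; exact: probability_setT.
rewrite /envelope; case: ifPn => [_|].
  rewrite mulr1 exprMn EFinM.
  apply: (@le_trans _ _ ((kappa ^+ 2)%:E * \int[P]_w (D w ^+ 2 * \1_setT w)%:E)%E); last first.
    by rewrite lee_wpmul2l// lee_fin sqr_ge0.
  rewrite -ge0_integralZl_EFin ?sqr_ge0//; last exact: mDA.
  apply: ge0_le_integral => //.
  - by move=> w _; rewrite lee_fin sqr_ge0.
  - by apply: emeasurable_funM => //; exact: mDA.
  move=> w _; rewrite -EFinM lee_fin indicT mulr1 exprMn mulrC.
  by rewrite ler_wpM2r ?sqr_ge0// lerXn2r ?nnegrE.
rewrite -ltNge => xs; have x0 : 0 < enorm x := lt_trans sigma0 xs.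
have r0 : 0 < enorm x / 2 by rewrite divr_gt0.
set A := [set w | enorm x / 2 < enorm (X w)].
have mA : measurable A.
  rewrite -[X in measurable X]setTI (_ : A = (fun w => enorm (X w)) @^-1` `]enorm x / 2, +oo[).
    exact: measurableT_comp (@measurable_enorm _ _) mX _ _ _.
  by apply/seteqP; split => w /=; rewrite /A/= in_itv/= andbT.
set t := m * _; set b := sigma `^ rho * _.
have t0 : 0 <= t by rewrite mulr_ge0// powR_ge0.
have b0 : 0 <= b by rewrite mulr_ge0// powR_ge0.
have HA : (\int[P]_w (D w ^+ 2 * \1_A w)%:E <= (N ^+ 2 * t ^+ 2)%:E)%E.
  apply: (le_trans (second_moment_on_event_le p1 pq mD mA N0 DN)).
  rewrite [leRHS]EFinM; apply: lee_wpmul2l; first by rewrite lee_fin sqr_ge0.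
  apply: (tail_probability_le p1 pq _ _ r0 Xm).
    exact: measurableT_comp (@measurable_enorm _ _) mX.
  by move=> w; exact: enorm_ge0.
apply: (@le_trans _ _ ((kappa ^+ 2)%:E * (\int[P]_w ((D w ^+ 2 * \1_A w)%:E +
    (b ^+ 2)%:E * (D w ^+ 2 * \1_setT w)%:E)))%E).
  rewrite -ge0_integralZl_EFin ?sqr_ge0//; last 2 first.
  - by move=> w _; rewrite adde_ge0// mule_ge0// lee_fin sqr_ge0.
  - by apply: emeasurable_funD; [exact: mDA|apply: emeasurable_funM => //; exact: mDA].
  apply: ge0_le_integral => //.
  - by move=> w _; rewrite lee_fin sqr_ge0.
  - apply: emeasurable_funM => //; apply: emeasurable_funD; first exact: mDA.
    by apply: emeasurable_funM => //; exact: mDA.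
  move=> w _; rewrite (_ : (kappa ^+ 2)%:E * _ = (kappa ^+ 2 * (D w ^+ 2 * \1_A w +
    b ^+ 2 * (D w ^+ 2 * \1_setT w)))%:E)%E// lee_fin indicT mulr1 exprMn indicE.
  case: (boolP (w \in A)) => wA.
    rewrite mulr1 mulrC ler_pM ?sqr_ge0 ?lerXn2r ?nnegrE//.
    by rewrite lerDl mulr_ge0 ?sqr_ge0.
  have Xr : enorm (X w) <= enorm x / 2.
    by move: wA; rewrite notin_setE /A/= => /negP; rewrite -leNgt.
  have fb : f (tsub x (X w)) <= kappa * b.
    by apply: (xi_density_tail_le sigma0 drho nuE) => //; exact: enorm_tsub_ge.
  rewrite mulr0 add0r mulrA -[kappa ^+ 2 * _]exprMn [leRHS]mulrC ler_wpM2l ?sqr_ge0//.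
  by rewrite lerXn2r ?nnegrE//; exact: mulr_ge0.
have -> : (kappa * N * (t + b)) ^+ 2 = kappa ^+ 2 * (N ^+ 2 * (t + b) ^+ 2) by ring.
rewrite [leRHS]EFinM; apply: lee_wpmul2l; first by rewrite lee_fin sqr_ge0.
rewrite ge0_integralD//; last 3 first.
- exact: mDA.
- by move=> w _; rewrite mule_ge0// lee_fin sqr_ge0.
- by apply: emeasurable_funM => //; exact: mDA.
rewrite ge0_integralZl_EFin ?sqr_ge0//; last exact: mDA.
apply: (@le_trans _ _ ((N ^+ 2 * t ^+ 2)%:E + (b ^+ 2)%:E * (N ^+ 2)%:E)%E).
  by rewrite leeD// lee_wpmul2l ?lee_fin ?sqr_ge0.
rewrite -EFinM -EFinD lee_fin mulrC [b ^+ 2 * _]mulrC [t ^+ 2 * _]mulrC -mulrDr.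
rewrite ler_wpM2l ?sqr_ge0//.
by rewrite sqrrD -addrA lerD2l addrC lerDl mulrn_wge0// mulr_ge0.
Qed.

End second_moment.

Lemma integral_envelope_le m : 0 <= m ->
  (\int[lebd d]_x (envelope m x)%:E <=
   (unit_ball_volume d * (sigma ^+ d + 2 * expR 1 *
      (m * 2 `^ (p - 1) * (d%:R / (p - 1 - d%:R)) * sigma `^ (d%:R - (p - 1))
       + (2 * sigma) `^ rho * (d%:R / (rho - d%:R)) * sigma `^ (d%:R - rho))))%:E)%E.
Proof.
move=> m0; have mE := measurable_envelope m.
have E0 x : (0 <= (envelope m x)%:E)%E by rewrite lee_fin envelope_ge0.
have mB : measurable (~` eball sigma : set E).
  by apply: measurableC; exact: measurable_eball.
rewrite -(setvU (eball sigma)) ge0_integral_setU//=; last 3 first.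
- exact: measurable_eball.
- by rewrite setvU; exact/measurable_EFinP.
- by rewrite disj_set2E setICl.
have da : d%:R < p - 1 by rewrite ltrBrDr.
have dr : d%:R < rho by apply: lt_trans drho; rewrite ltrDl.
rewrite [leRHS](_ : _ = (m * 2 `^ (p - 1))%:E * (tail_bound d (p - 1) sigma)%:E +
   ((2 * sigma) `^ rho)%:E * (tail_bound d rho sigma)%:E +
   (sigma ^+ d * unit_ball_volume d)%:E)%E; last first.
  by rewrite -!EFinM -!EFinD; congr EFin; rewrite /tail_bound; ring.
apply: leeD; last first.
  rewrite -lebd_ball// -[leRHS]mul1e -integral_cst; last exact: measurable_eball.
  apply: ge0_le_integral => //.
  - exact: measurable_eball.
  - by apply: measurable_funTS; exact/measurable_EFinP.
  by move=> x xs; rewrite /envelope ifT.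
have mt a : measurable_fun (~` eball sigma : set E) (fun x => (enorm x `^ (- a))%:E).
  by apply: measurable_funTS; apply/measurable_EFinP; exact: measurable_powR_enorm.
apply: (@le_trans _ _
   ((m * 2 `^ (p - 1))%:E *
      \int[lebd d]_(x in ~` eball sigma) (enorm x `^ (- (p - 1)))%:E +
    ((2 * sigma) `^ rho)%:E *
      \int[lebd d]_(x in ~` eball sigma) (enorm x `^ (- rho))%:E)%E); last first.
  by apply: leeD; apply: lee_wpmul2l; rewrite ?lee_fin ?mulr_ge0 ?powR_ge0//;
    exact: tail_integral_le.
have c1 : 0 <= m * 2 `^ (p - 1) by rewrite mulr_ge0 ?powR_ge0.
have pow0 a (x : E) : (~` eball sigma) x -> (0 <= (enorm x `^ (- a))%:E)%E.
  by rewrite lee_fin powR_ge0.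
rewrite -!ge0_integralZl_EFin ?powR_ge0//; [|exact: pow0|exact: pow0].
rewrite -ge0_integralD//; last 4 first.
- by move=> x _; rewrite -EFinM lee_fin mulr_ge0 ?powR_ge0.
- by apply: emeasurable_funM.
- by move=> x _; rewrite -EFinM lee_fin mulr_ge0 ?powR_ge0.
- by apply: emeasurable_funM.
rewrite le_eqVlt; apply/orP; left; apply/eqP; apply: eq_integral => x.
rewrite in_setC in_eball => xs; rewrite /envelope (negbTE xs) -!EFinM -EFinD.
have x0 : 0 < enorm x by rewrite (lt_trans sigma0)// ltNge.
have half a : (enorm x / 2) `^ (- a) = 2 `^ a * enorm x `^ (- a).
  by rewrite powRM ?enorm_ge0// -[2^-1]powR_inv1// -powRrM mulN1r opprK mulrC.
by rewrite !half powRM ?(ltW sigma0)//; congr EFin; ring.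
Qed.

End rate.

(** * Expected cost of the projection *)

Section expected_cost.
Context {R : realType} (d : nat).
Local Notation E := (d.-tuple R).
Variables (rho sigma p q : R).
Variables (dO : measure_display) (Om : measurableType dO) (P : probability Om R)
    (X Y : {RV P >-> d.-tuple R})
    (dS : measure_display) (Sm : measurableType dS) (PS : probability Sm R)
    (n : nat) (n_gt0 : (0 < n)%N)
    (XY : 'I_n -> {RV PS >-> (d.-tuple R * d.-tuple R)%type})
    (nu : probability (d.-tuple R) R).
Hypotheses (d0 : (0 < d)%N) (sigma0 : 0 < sigma) (drho : d%:R + 1 < rho)
  (dp : d%:R + 1 < p) (pq : p^-1 + q^-1 = 1)
  (mart : martingale_pair P X Y)
  (law : forall i A, measurable A -> PS (XY i @^-1` A) = P [set w | A (X w, Y w)])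
  (indep : independent_family PS (fun i => XY i : Sm -> (d.-tuple R * d.-tuple R)%type))
  (nuE : has_density nu (xi_density rho sigma)).

Let f : E -> R := xi_density rho sigma.
Let kappa : R := sigma ^- d * C_ d rho.

Let k0 : 0 <= kappa.
Proof. by rewrite mulr_ge0 ?C_ge0// invr_ge0 exprn_ge0// ltW. Qed.

Let mf : measurable_fun setT f. Proof. exact: measurable_xi_density. Qed.

Let f_gt0 x : 0 < f x. Proof. exact: xi_density_gt0 sigma0 nuE x. Qed.

Variables (m2 : R) (N : 'I_d -> R).
Hypotheses (Xm : (\int[P]_w (enorm (X w) `^ (2 * p))%:E = m2%:E)%E)
  (N0 : forall j, 0 <= N j)
  (DN : forall j, Lnorm P (2 * p)%:E (EFin \o (fun w => tnth (Y w) j - tnth (X w) j)) = (N j)%:E).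

Let mtn (j : 'I_d) : measurable_fun setT (fun x : E => tnth x j).
Proof. exact: measurable_tnth. Qed.

Definition summand (j : 'I_d) (x : E) (z : E * E) : R :=
  tnth (tsub z.2 z.1) j * f (tsub x z.1).

Let msummand j : measurable_fun setT (fun u : (E * E) * E => summand j u.2 u.1).
Proof.
have m11 : measurable_fun setT (fun u : (E * E) * E => u.1.1) by exact: measurableT_comp.
apply: measurable_funM.
  apply: measurableT_comp (mtn j) _; apply: measurable_tsub => //.
  exact: measurableT_comp.
by apply: measurableT_comp mf _; exact: measurable_tsub.
Qed.

(** The summands are centred, as [Y - X] is orthogonal to functions of [X], so the
    sum is of the order of the square root of [n]. *)
Lemma expected_drift_le (j : 'I_d) (x : E) :
  (\int[PS]_w `|\sum_(i < n) summand j x (XY i w)|%:E <=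
   (Num.sqrt n%:R * (kappa * N j * envelope rho sigma p (m2 `^ (2 * q)^-1) x))%:E)%E.
Proof.
set B := kappa * N j * _.
have B0 : 0 <= B by rewrite mulr_ge0 ?envelope_ge0 ?powR_ge0// mulr_ge0.
have mX : measurable_fun setT X by [].
have mY : measurable_fun setT Y by [].
have mXY : measurable_fun setT (fun w => (X w, Y w)) by exact: measurable_fun_pair.
pose pairXY : {mfun Om >-> (E * E)%type} := HB.pack (fun w => (X w, Y w))
  (isMeasurableFun.Build _ _ _ _ _ mXY).
pose mu := distribution P pairXY.
pose D w := tnth (Y w) j - tnth (X w) j.
have mD : measurable_fun setT D.
  by apply: measurable_funB; apply: measurableT_comp (mtn j) _.
have mh : measurable_fun setT (summand j x).
  exact: measurableT_comp (msummand j) (pair2_measurable x).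
have sE w : summand j x (X w, Y w) = D w * f (tsub x (X w)).
  by rewrite /summand /= tnth_mktuple.
have h2 : (\int[mu]_z (summand j x z ^+ 2)%:E <= (B ^+ 2)%:E)%E.
  rewrite /mu/= /distribution (ge0_integral_pushforward mXY)//=; last 2 first.
  - by apply/measurable_EFinP; exact: measurable_funX.
  - by move=> z _; rewrite lee_fin sqr_ge0.
  rewrite preimage_setT; under eq_integral do rewrite sE.
  exact: (weighted_second_moment_le sigma0 drho dp pq nuE mX mD (N0 j) (DN j) Xm).
have h1 : (\int[mu]_z (summand j x z)%:E = 0)%E.
  have iD : P.-integrable setT (EFin \o (summand j x \o pairXY)).
    have [iY iX _ _] := mart j.
    have iDk : P.-integrable setT (fun w => kappa%:E *
        ((EFin \o (fun w => tnth (Y w) j)) w - (EFin \o (fun w => tnth (X w) j)) w))%E.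
      by apply: integrableZl => //; exact: integrableB.
    apply: (le_integrable measurableT _ _ iDk).
      by apply/measurable_EFinP; exact: measurableT_comp mh mXY.
    move=> w _ /=; rewrite lee_fin sE normrM [in leRHS]normrM mulrC.
    rewrite (ger0_norm k0) (ger0_norm (ltW (f_gt0 _))).
    by apply: ler_pM => //; [exact/ltW/f_gt0|exact: (xi_density_le sigma0 drho nuE)].
  rewrite /mu/= /distribution (integral_pushforward mXY)//=; last first.
    by apply/measurable_EFinP.
  rewrite preimage_setT; under eq_integral do rewrite sE.
  apply: (cond_exp_orthogonal mX (K := kappa) (mart j) (phi := fun y => f (tsub x y))).
    by apply: measurableT_comp mf _; exact: measurable_tsub.
  move=> y; rewrite (ltW (f_gt0 _))/=; exact: (xi_density_le sigma0 drho nuE).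
apply: (iid_sum_L1 (mu := mu) _ indep mh _ h1).
- by move=> i A mA; rewrite law.
- by rewrite (le_lt_trans h2)// ltry.
- by rewrite mulr_ge0// sqrtr_ge0.
rewrite exprMn sqr_sqrtr// EFinM; exact: lee_wpmul2l.
Qed.

Lemma expected_smoothed_MPD_le :
  (\int[PS]_w smoothed_MPD nu (empirical (fun i => XY i w) n_gt0) <=
   (n%:R^-1 * (Num.sqrt n%:R * kappa * \sum_(j < d) N j))%:E *
   \int[lebd d]_x (envelope rho sigma p (m2 `^ (2 * q)^-1) x)%:E)%E.
Proof.
pose G w x := \sum_(j < d) `|\sum_(i < n) summand j x (XY i w)|.
have mG : measurable_fun setT (fun u : Sm * E => (G u.1 u.2)%:E).
  apply/measurable_EFinP; apply: measurable_sum => j; apply: measurableT_comp => //.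
  apply: measurable_sum => i.
  have mu : measurable_fun setT (fun u : Sm * E => (XY i u.1, u.2)).
    apply: measurable_fun_pair => //; exact: measurableT_comp.
  exact: measurableT_comp (msummand j) mu.
have G0 u : (0 <= (G u.1 u.2)%:E)%E by rewrite lee_fin; apply: sumr_ge0.
apply: (@le_trans _ _ (\int[PS]_w ((n%:R^-1)%:E * \int[lebd d]_x (G w x)%:E))%E).
  apply: ge0_le_lower_integral => w.
    apply: le_ereal_inf_tmp => _ [Q _ <-]; apply: le_ereal_inf_tmp => _ [pi _ <-].
    by apply: integral_ge0 => z _; rewrite lee_fin addr_ge0 ?enorm_ge0.
  exact: (smoothed_MPD_le n_gt0 (fun i => XY i w) mf f_gt0 nuE
    (xi_first_moment d0 sigma0 drho nuE)).
rewrite ge0_integralZl_EFin//; last 2 first.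
- by move=> w _; apply: integral_ge0 => x _; exact: (G0 (w, x)).
- exact: (measurable_fun_fubini_tonelli_F (m2 := lebd d) _ mG).
rewrite (fubini_tonelli (m1 := PS) (m2 := lebd d) (fun u => (G u.1 u.2)%:E))//=.
rewrite EFinM -muleA; apply: lee_wpmul2l; first by rewrite lee_fin invr_ge0.
have SN0 : 0 <= \sum_(j < d) N j by exact: sumr_ge0.
rewrite -ge0_integralZl_EFin//; last 3 first.
- by move=> x _; rewrite lee_fin envelope_ge0// powR_ge0.
- by apply/measurable_EFinP; exact: measurable_envelope.
- by rewrite mulr_ge0// mulr_ge0// sqrtr_ge0.
apply: ge0_le_integral => //.
- by move=> x _; apply: integral_ge0 => w _; exact: (G0 (w, x)).
- exact: (measurable_fun_fubini_tonelli_G (m1 := PS) _ mG).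
- by apply: emeasurable_funM => //; apply/measurable_EFinP; exact: measurable_envelope.
move=> x _; rewrite /G; under eq_integral do rewrite -sumEFin.
have mj j : measurable_fun setT (fun w => `|\sum_(i < n) summand j x (XY i w)|%:E).
  apply/measurable_EFinP; apply: measurableT_comp => //; apply: measurable_sum => i.
  have mu : measurable_fun setT (fun w => (XY i w, x)) by exact: measurable_fun_pair.
  exact: measurableT_comp (msummand j) mu.
rewrite ge0_integral_sum//.
apply: (le_trans (lee_sum _ (fun j _ => expected_drift_le j x))).
rewrite sumEFin -EFinM lee_fin -mulr_sumr -mulr_suml -mulr_sumr.
by rewrite le_eqVlt; apply/orP; left; apply/eqP; ring.
Qed.

End expected_cost.

(** * Finiteness of the norms and the final constants *)

Lemma enorm_le_pair {R : realType} d (z : d.-tuple R * d.-tuple R) :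
  enorm z.1 <= enorm_pair z /\ enorm z.2 <= enorm_pair z.
Proof.
by split; rewrite /enorm /enorm_pair ler_wsqrtr// ?lerDl ?lerDr sumr_ge0// => i _; exact: sqr_ge0.
Qed.

Lemma measurable_enorm_pair {R : realType} d :
  measurable_fun setT (fun z : d.-tuple R * d.-tuple R => enorm_pair z).
Proof.
apply: (measurableT_comp (@measurable_sqrt R)).
by apply: measurable_funD; apply: measurable_sum => i; apply: measurable_funX;
  apply: (measurableT_comp (@measurable_tnth _ _ _ i)).
Qed.

Lemma Lnorm_lt_pinfty {R : realType} dO (Om : measurableType dO) (P : probability Om R)
    (r c : R) (V D : Om -> R) :
  0 < r -> 0 <= c -> measurable_fun setT V -> measurable_fun setT D -> (forall w, 0 <= V w) ->
  (\int[P]_w (V w `^ r)%:E < +oo)%E -> (forall w, `|D w| <= c * V w) ->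
  (Lnorm P r%:E (EFin \o D) < +oo)%E.
Proof.
move=> r0 c0 mV mD V0 Voo DV; rewrite unlock; apply: poweR_lty.
have mVr : measurable_fun setT (fun w => (V w `^ r)%:E).
  by apply/measurable_EFinP; exact: measurableT_comp (measurable_powR _) mV.
have mDr : measurable_fun setT (fun w => (`|D w| `^ r)%:E).
  apply/measurable_EFinP; apply: measurableT_comp (measurable_powR _) _.
  exact: measurableT_comp.
apply: (@le_lt_trans _ _ ((c `^ r)%:E * \int[P]_w (V w `^ r)%:E)%E); last first.
  by rewrite lte_mul_pinfty// lee_fin powR_ge0.
rewrite -ge0_integralZl_EFin ?powR_ge0//; last by move=> w _; rewrite lee_fin powR_ge0.
apply: ge0_le_integral => //.
- by move=> w _ /=; rewrite lee_fin powR_ge0.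
- by apply: emeasurable_funM.
move=> w _ /=; rewrite -EFinM lee_fin -powRM//.
by apply: ge0_ler_powR; rewrite ?nnegrE ?mulr_ge0// ltW.
Qed.

Section constants.
Context {R : realType}.

(** The powers of [sigma] cancel against the normalisation of the density; the
    volume of the unit ball and the constant of [tail_integral_le] go into the
    universal factor, and [1 <= T3] absorbs the contribution of the ball of radius
    [sigma]. *)
Lemma combine_constants (d n : nat) (sigma rho p m U C SN T1 T3 : R) :
  (0 < d)%N -> (0 < n)%N -> 0 < sigma -> d%:R + 1 < rho -> d%:R + 1 < p ->
  0 <= m -> 0 <= U -> 0 <= C -> 0 <= SN -> 0 <= T1 -> 1 <= T3 -> U <= expR pi ->
  n%:R^-1 * (Num.sqrt n%:R * (sigma ^- d * C) * SN) *
  (U * (sigma ^+ d + 2 * expR 1 *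
     (m * 2 `^ (p - 1) * (d%:R / (p - 1 - d%:R)) * sigma `^ (d%:R - (p - 1))
      + (2 * sigma) `^ rho * (d%:R / (rho - d%:R)) * sigma `^ (d%:R - rho)))) <=
  (2 * expR 1 * expR pi) * n%:R `^ (- (1 / 2)) * SN * C *
  (T1 + d%:R * (m * (2 `^ (p - 1) * (sigma `^ (- (p - 1)) / (p - 1 - d%:R))) +
      (2 `^ rho * (1 / (rho - d%:R)))) + T3).
Proof.
move=> d0 n0 s0 drho dp m0 U0 C0 SN0 T10 T31 Upi.
have n0' : 0 < n%:R :> R by rewrite ltr0n.
have nE : n%:R^-1 * Num.sqrt n%:R = n%:R `^ (- (1 / 2)) :> R.
  rewrite -powR12_sqrt ?(ltW n0')// -[X in X * _](powR_inv1 (ltW n0')).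
  by rewrite -powRD ?(gt_eqF n0') ?implybT//; congr (_ `^ _); field.
have sE a : sigma `^ (d%:R - a) = sigma ^+ d * sigma `^ (- a).
  by rewrite powRD ?(gt_eqF s0) ?implybT// powR_mulrn// ltW.
have sr : (2 * sigma) `^ rho * sigma `^ (- rho) = 2 `^ rho.
  by rewrite powRM ?(ltW s0)// powRN mulfK// gt_eqF// powR_gt0.
have sd : sigma ^+ d != 0 by rewrite expf_neq0// gt_eqF.
set A := m * (2 `^ (p - 1) * (sigma `^ (- (p - 1)) / (p - 1 - d%:R))).
set B := 2 `^ rho * (1 / (rho - d%:R)).
have -> : n%:R^-1 * (Num.sqrt n%:R * (sigma ^- d * C) * SN) *
  (U * (sigma ^+ d + 2 * expR 1 *
     (m * 2 `^ (p - 1) * (d%:R / (p - 1 - d%:R)) * sigma `^ (d%:R - (p - 1))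
      + (2 * sigma) `^ rho * (d%:R / (rho - d%:R)) * sigma `^ (d%:R - rho)))) =
  n%:R `^ (- (1 / 2)) * SN * C * (U * (1 + 2 * expR 1 * (d%:R * (A + B)))).
  rewrite !sE -nE /A /B -sr; field.
  by rewrite sd /= !gt_eqF// ?subr_gt0//; lra.
set K := _ `^ _ * SN * C.
have K0 : 0 <= K by rewrite !mulr_ge0 ?powR_ge0.
rewrite -(mulrA (2 * expR 1 * expR pi)) -(mulrA (2 * expR 1 * expR pi)) -/K.
have -> a b : a * K * b = K * (a * b) by move=> *; ring.
apply: ler_wpM2l => //.
have AB0 : 0 <= d%:R * (A + B).
  rewrite mulr_ge0// addr_ge0// mulr_ge0 ?powR_ge0//.
    by rewrite mulr_ge0 ?powR_ge0// divr_ge0 ?powR_ge0//; lra.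
  by rewrite divr_ge0//; lra.
have e1 : 1 <= 2 * expR 1 :> R by have := expR_ge1Dx (1 : R); lra.
set Z := d%:R * (A + B) in AB0 *; set e := 2 * expR 1 in e1 *.
have e0 : 0 <= e by exact: le_trans e1.
have Z1 : 1 + e * Z <= e * (T1 + Z + T3).
  have h1 : 1 <= e * T3 by rewrite -[leLHS]mulr1 ler_pM.
  have h2 : 0 <= e * T1 by rewrite mulr_ge0.
  rewrite !mulrDr; lra.
rewrite (@le_trans _ _ (expR pi * (1 + e * Z)))//.
  by rewrite ler_wpM2r// addr_ge0// mulr_ge0.
have -> : e * expR pi * (T1 + Z + T3) = expR pi * (e * (T1 + Z + T3)) by ring.
by rewrite ler_wpM2l// expR_ge0.
Qed.

End constants.

Theorem proposition3 (R : realType) :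
  exists L : R, 0 < L /\
  forall (d : nat) (sigma rho p q : R)
    (dO : measure_display) (Om : measurableType dO) (P : probability Om R)
    (X Y : {RV P >-> d.-tuple R})
    (dS : measure_display) (Sm : measurableType dS) (PS : probability Sm R)
    (n : nat) (n_gt0 : (0 < n)%N)
    (XY : 'I_n -> {RV PS >-> (d.-tuple R * d.-tuple R)%type})
    (nu : probability (d.-tuple R) R),
  (0 < d)%N -> 0 < sigma -> d%:R + 1 < rho -> d%:R + 1 < p ->
  p^-1 + q^-1 = 1 ->
  martingale_pair P X Y ->
  (\int[P]_w (enorm_pair (X w, Y w) `^ (2 * p))%:E < +oo)%E ->
  (forall i A, measurable A ->
     PS (XY i @^-1` A) = P [set w | A (X w, Y w)]) ->
  independent_family PS (fun i => XY i : Sm -> (d.-tuple R * d.-tuple R)%type) ->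
  has_density nu (xi_density rho sigma) ->
  let M := ((\int[P]_w (enorm (X w) `^ (2 * p))%:E) `^ (1 / (2 * q)))%E in
  (\int[PS]_w smoothed_MPD nu (empirical (fun i => XY i w) n_gt0) <=
   (L * n%:R `^ (- (1 / 2)))%:E *
   (\sum_(j < d)
      Lnorm P (2 * p)%:E (fun w => (tnth (X w) j - tnth (Y w) j)%:E)) *
   (C_ d rho)%:E *
   ((d%:R `^ (3 / 2) * rho)%:E *
      (M * (2 `^ (p - 1) * (sigma `^ (- p) / (p - 1 - d%:R)))%:E +
       (2 `^ (rho + 1) * (sigma^-1 / (rho + 1 - d%:R)))%:E) +
    d%:R%:E *
      (M * (2 `^ (p - 1) * (sigma `^ (- (p - 1)) / (p - 1 - d%:R)))%:E +
       (2 `^ rho * (1 / (rho - d%:R)))%:E) +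
    ((Num.sqrt d%:R * rho * sigma ^- d.+1 + sigma ^- d) *
       (sigma ^+ d + 1))%:E))%E.
Proof.
exists (2 * expR 1 * expR pi); split; first by rewrite !mulr_gt0// expR_gt0.
move=> d sigma rho p q dO Om P X Y dS Sm PS n n_gt0 XY nu d0 sigma0 drho dp pq.
move=> mart mom law indep nuE.
cbv zeta; set M := (_ `^ (1 / (2 * q)))%E.
have dge0 : 0 <= d%:R :> R by [].
have p20 : 0 < 2 * p by lra.
have mX : measurable_fun setT X by [].
have mY : measurable_fun setT Y by [].
have mpair : measurable_fun setT (fun w => enorm_pair (X w, Y w)).
  apply: measurableT_comp (@measurable_enorm_pair R d) _; exact: measurable_fun_pair.
have pair0 w : 0 <= enorm_pair (X w, Y w) by exact: sqrtr_ge0.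
pose I := (\int[P]_w (enorm (X w) `^ (2 * p))%:E)%E.
have I0 : (0 <= I)%E by apply: integral_ge0 => w _; rewrite lee_fin powR_ge0.
have Ioo : (I < +oo)%E.
  apply: (le_lt_trans _ mom); rewrite /I; apply: ge0_le_integral.
  - exact: measurableT.
  - by move=> w _; rewrite lee_fin powR_ge0.
  - apply/measurable_EFinP; apply: measurableT_comp (measurable_powR _) _.
    exact: measurableT_comp (@measurable_enorm _ _) mX.
  - by apply/measurable_EFinP; exact: measurableT_comp (measurable_powR _) mpair.
  move=> w _; rewrite lee_fin.
  have [xy _] := enorm_le_pair (X w, Y w).
  by apply: (ge0_ler_powR (ltW p20)) xy; rewrite nnegrE; [exact: enorm_ge0|exact: pair0].
have [m2 Xm] : exists m2, (\int[P]_w (enorm (X w) `^ (2 * p))%:E = m2%:E)%E.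
  by exists (fine I); rewrite fineK// (ge0_fin_numE I0).
clear I I0 Ioo.
pose N (j : 'I_d) := fine (Lnorm P (2 * p)%:E (EFin \o (fun w => tnth (Y w) j - tnth (X w) j))).
have mD j : measurable_fun setT (fun w => tnth (Y w) j - tnth (X w) j).
  by apply: measurable_funB; apply: (measurableT_comp (@measurable_tnth _ _ _ j)).
have DN j : Lnorm P (2 * p)%:E (EFin \o (fun w => tnth (Y w) j - tnth (X w) j)) = (N j)%:E.
  rewrite /N fineK// ge0_fin_numE ?Lnorm_ge0//.
  apply: (Lnorm_lt_pinfty (c := 2) p20 _ mpair (mD j) pair0 mom) => // w.
  rewrite (le_trans (ler_normB _ _))//.
  have [h1 h2] := enorm_le_pair (X w, Y w).
  have := abs_tnth_le_enorm (X w) j; have := abs_tnth_le_enorm (Y w) j.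
  by move: h1 h2 => /=; lra.
have N0 j : 0 <= N j by rewrite fine_ge0// Lnorm_ge0.
pose m := m2 `^ (2 * q)^-1.
have m0 : 0 <= m by exact: powR_ge0.
have ME : M = m%:E by rewrite /M Xm poweR_EFin div1r.
have SE : (\sum_(j < d) Lnorm P (2 * p)%:E (fun w => (tnth (X w) j - tnth (Y w) j)%:E))%E =
    (\sum_(j < d) N j)%:E.
  rewrite -sumEFin; apply: eq_bigr => j _; rewrite -DN -[RHS]oppe_Lnorm.
  by apply: eq_Lnorm => w; rewrite /= opprB.
apply: (le_trans (expected_smoothed_MPD_le n_gt0 d0 sigma0 drho dp pq mart law indep nuE Xm N0 DN)).
have C0 := C_ge0 d rho.
have k0 : 0 <= n%:R^-1 * (Num.sqrt n%:R * (sigma ^- d * C_ d rho) * \sum_(j < d) N j).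
  rewrite mulr_ge0 ?invr_ge0// mulr_ge0 ?sumr_ge0// mulr_ge0 ?sqrtr_ge0// mulr_ge0//.
  by rewrite invr_ge0 exprn_ge0// ltW.
apply: (le_trans (lee_wpmul2l _ (integral_envelope_le d0 sigma0 drho dp m0))).
  by rewrite lee_fin.
rewrite SE ME -EFinM lee_fin.
apply: combine_constants => //; try exact: unit_ball_volume_ge0; try exact: unit_ball_volume_le.
- exact: sumr_ge0.
- have i1 : 0 <= (rho + 1 - d%:R)^-1 by rewrite invr_ge0; lra.
  have i2 : 0 <= (p - 1 - d%:R)^-1 by rewrite invr_ge0; lra.
  have i3 : 0 <= sigma^-1 by rewrite invr_ge0 ltW.
  have rho0 : 0 <= rho by lra.
  by apply: mulr_ge0; [exact: mulr_ge0 (powR_ge0 _ _) _|apply: addr_ge0];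
    rewrite ?mulr_ge0 ?powR_ge0.
- have s0 : 0 <= sigma := ltW sigma0.
  have sd0 : 0 < sigma ^+ d by rewrite exprn_gt0.
  rewrite mulrDl -[leLHS]add0r lerD//.
    rewrite !mulr_ge0 ?sqrtr_ge0 ?invr_ge0 ?exprn_ge0 ?addr_ge0 ?exprn_ge0//; lra.
  by rewrite mulrDr mulVf ?gt_eqF// mulr1 lerDl invr_ge0 ltW.
Qed.
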